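(* Let $A$ be an infinite, uniformly discrete, locally finite, pointed metric space, and let $X$ be a visual, hyperbolic, pointed metric space. If $A$ rough biLipschitzly embeds into $X$ and $\partial X$ log-stochastic biLipschitzly embeds (for every choice of basepoint in $\partial X$) into a bounded, pointed ultrametric space, then $A$ stochastic biLipschitzly embeds into a pointed $\mathbb{R}$-tree and $\mathrm{LF}(A) \approx \ell^1$.
   Context: A pointed metric space is a metric space with a distinguished basepoint. $(A,d)$ is uniformly discrete if there is $\theta>0$ with $d(x,y)\ge\theta$ for all $x\ne y$, and locally finite if all bounded sets are finite. A map $f:(X,d_X)\to(Y,d_Y)$ (not required to preserve basepoints) is a rough biLipschitz embedding if there are $K,L<\infty$ with $L^{-1}d_X(x,y)-K\le d_Y(f(x),f(y))\le Ld_X(x,y)+K$ for all $x,y$. Hyperbolic spaces. The Gromov product is $(x|y)_p:=\frac12(d(x,p)+d(p,y)-d(x,y))$. $X$ is hyperbolic if for some $\delta\in[0,\infty)$, $(x|z)_p\ge\min\{(x|y)_p,(y|z)_p\}-\delta$ for all $x,y,z,p\in X$. A sequence $(x_i)$ converges at $\infty$ if $\lim_{i,j\to\infty}(x_i|x_j)_p=\infty$ for some (equivalently all) $p$; two such sequences are equivalent if $\lim_i(x_i|y_i)_p=\infty$. The boundary $\partial X$ is the set of equivalence classes. For $\xi,\upsilon\in\partial X$, $(\xi|\upsilon)_p:=\sup\{\liminf_i(x_i|y_i)_p:(x_i)\in\xi,(y_i)\in\upsilon\}$. A metric $d$ on $\partial X$ is visual if there are $p\in X$, $\varepsilon>0$,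 $C<\infty$ with $C^{-1}e^{-\varepsilon(\xi|\upsilon)_p}\le d(\xi,\upsilon)\le Ce^{-\varepsilon(\xi|\upsilon)_p}$. Visual metrics exist and any two are snowflake equivalent; $\partial X$ is always equipped with some visual metric, and the log-stochastic embeddability property in the claim does not depend on which one. A $K$-rough geodesic ray is the image of a map $f:[0,\infty)\to X$ with $|s-t|-K\le d(f(s),f(t))\le|s-t|+K$ for all $s,t$; its origin is $f(0)$. $X$ is visual if there exist $p\in X$ and $K'<\infty$ such that $X$ is the union of all $K'$-rough geodesic rays with origin $p$. Random embeddings. A random map $\phi=\{\phi_\omega:X\to Y\}_{\omega\in\Omega}$ between pointed metric spaces $(X,d_X,x_0)$, $(Y,d_Y,y_0)$ is a family of maps indexed by a probability space $(\Omega,\mathcal{F},\mathbb{P})$ such that: for every $x\in X$, $\omega\mapsto\phi_\omega(x)$ is measurable (Borel $\sigma$-algebra on $Y$); for every $x\in X$ there are a separable $S\subseteq Y$ and a $\mathbb{P}$-null set $N$ with $\phi_\omega(x)\in S$ for all $\omega\notin N$; and $\phi_\omega(x_0)=y_0$ for almost every $\omega$. It is a stochastic biLipschitz embedding if there are $D<\infty$ (distortion) and $s\in(0,\infty)$ (scaling factor) such that for all $x,y\in X$: (i) $d_Y(\phi_\omega(x),\phi_\omega(y))\ge s\,d_X(x,y)$ for almost every $\omega$, and (ii) $\mathbb{E}_\omega[d_Y(\phi_\omega(x),\phi_\omega(y))]\le sD\,d_X(x,y)$. It is a log-stochastic biLipschitz embedding if instead of (ii), $\mathbb{E}_\omega[\log(d_Y(\phi_\omega(x),\phi_\omega(y)))]\le\log(sD\,d_X(x,y))$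 (with $\log 0=-\infty$). ''Embeds'' means such an embedding exists for some $D,s$. An ultrametric space is a metric space with $d(u,w)\le\max\{d(u,v),d(v,w)\}$. An $\mathbb{R}$-tree is a metric space in which any two points are the endpoints of a unique arc, and this arc is a geodesic. For a pointed metric space $A$, $\mathrm{Lip}_0(A)$ is the Banach space of real Lipschitz functions vanishing at the basepoint, normed by the Lipschitz constant; $\mathrm{LF}(A)$ is the closed linear span in $\mathrm{Lip}_0(A)^*$ of the evaluation functionals $\delta_x$, $x\in A$. $V\approx W$ means the real Banach spaces $V,W$ are isomorphic. $\ell^1=\ell^1(\mathbb{N})$. *)

(* Defs.v *)
From HB Require Import structures.
From mathcomp Require Import all_boot all_order all_algebra.
From mathcomp Require Import all_classical all_reals all_analysis.

Set Implicit Arguments.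
Unset Strict Implicit.
Unset Printing Implicit Defensive.

Import Order.TTheory GRing.Theory Num.Theory.
Import numFieldNormedType.Exports.

Local Open Scope classical_set_scope.
Local Open Scope ring_scope.

Section MetricSpaces.
Context {R : realType}.

Definition bounded_subset (A : metricType R) (B : set A) : Prop :=
  exists r : R, forall x y, B x -> B y -> mdist x y <= r.

Definition bounded_space (A : metricType R) : Prop := bounded_subset [set: A].

Definition uniformly_discrete (A : metricType R) : Prop :=
  exists2 theta : R, 0 < theta & forall x y : A, x <> y -> theta <= mdist x y.

Definition locally_finite_space (A : metricType R) : Prop :=
  forall B : set A, bounded_subset B -> finite_set B.

Definition rough_biLipschitz (X Y : metricType R) (f : X -> Y) : Prop :=
  exists K L : R, [/\ 0 <= K, 0 < L &
    forall x y, L^-1 * mdist x y - K <= mdist (f x) (f y) /\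
                mdist (f x) (f y) <= L * mdist x y + K].

Definition rough_biLipschitz_embeds (X Y : metricType R) : Prop :=
  exists f : X -> Y, rough_biLipschitz f.

Definition ultrametric (U : metricType R) : Prop :=
  forall u v w : U, mdist u w <= Num.max (mdist u v) (mdist v w).

(* [0, 1] is compact and metric spaces are Hausdorff, so a continuous
   injection of [0, 1] is a homeomorphism onto its image. *)
Definition is_arc (T : metricType R) (x y : T) (S : set T) : Prop :=
  exists f : R -> T, [/\ {within `[0, 1], continuous f},
    {in `[0, 1] &, injective f}, f 0 = x, f 1 = y & S = f @` `[0, 1]].

Definition is_geodesic (T : metricType R) (x y : T) (S : set T) : Prop :=
  exists f : R -> T, [/\ f 0 = x, f (mdist x y) = y,
    {in `[0, mdist x y] &, forall s t, mdist (f s) (f t) = `|s - t|} &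
    S = f @` `[0, mdist x y]].

(* Only distinct points are constrained: with x = y the arc is degenerate. *)
Definition Rtree (T : metricType R) : Prop :=
  forall x y : T, x <> y ->
    exists S : set T, [/\ is_arc x y S, forall S', is_arc x y S' -> S' = S
                        & is_geodesic x y S].

Definition separable_set (Y : metricType R) (S : set Y) : Prop :=
  exists D : set Y, [/\ countable D, D `<=` S & S `<=` closure D].

End MetricSpaces.

Section Hyperbolic.
Context {R : realType} (X : metricType R).

Definition gromov_prod (p x y : X) : R :=
  (mdist x p + mdist p y - mdist x y) / 2.

Definition hyperbolic : Prop :=
  exists2 delta : R, 0 <= delta & forall x y z p : X,
    Num.min (gromov_prod p x y) (gromov_prod p y z) - delta
      <= gromov_prod p x z.

Definition rough_geodesic_ray (K : R) (o : X) (S : set X) : Prop :=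
  exists f : R -> X, [/\ f 0 = o,
    forall s t, 0 <= s -> 0 <= t ->
      `|s - t| - K <= mdist (f s) (f t) /\ mdist (f s) (f t) <= `|s - t| + K &
    S = f @` `[0, +oo[].

Definition visual : Prop :=
  exists (p : X) (K : R), [set: X] = \bigcup_(S in rough_geodesic_ray K p) S.

Definition cvg_infty (x : nat -> X) : Prop :=
  exists p, gromov_prod p (x ij.1) (x ij.2) @[ij --> (\oo, \oo)] --> +oo.

Definition equiv_infty (x y : nat -> X) : Prop :=
  exists p, gromov_prod p (x i) (y i) @[i --> \oo] --> +oo.

(* A boundary point is the set of all sequences equivalent to some sequence
   converging at infinity.  [equiv_infty] is an equivalence relation on such
   sequences only when X is hyperbolic, hence no quotient type. *)
Definition boundary_classes : set (set (nat -> X)) :=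
  [set xi | exists2 x, cvg_infty x &
              xi = [set y | cvg_infty y /\ equiv_infty x y]].

Definition boundary : Type := set_type boundary_classes.

Definition boundary_prod (p : X) (xi ups : boundary) : \bar R :=
  ereal_sup [set limn_einf (fun i => (gromov_prod p (x i) (y i))%:E)
            | x in set_val xi & y in set_val ups].

Definition is_visual_dist (d : boundary -> boundary -> R) : Prop :=
  exists (p : X) (eps C : R), [/\ 0 < eps, 0 < C & forall xi ups,
    (C^-1%:E * expeR (- (eps%:E * boundary_prod p xi ups)) <= (d xi ups)%:E /\
     (d xi ups)%:E <= C%:E * expeR (- (eps%:E * boundary_prod p xi ups)))%E].

Record visual_metric := VisualMetric {
  vdist :> boundary -> boundary -> R ;
  vdistxx : forall xi, vdist xi xi = 0 ;
  vdist_positivity : forall xi ups, vdist xi ups = 0 -> xi = ups ;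
  vdist_sym : forall xi ups, vdist xi ups = vdist ups xi ;
  vdist_triangle : forall ups xi zeta,
    vdist xi zeta <= vdist xi ups + vdist ups zeta ;
  vdist_visual : is_visual_dist vdist }.

End Hyperbolic.

(* The boundary carrying a chosen visual metric as its metric structure. *)
Definition visual_boundary {R : realType} {X : metricType R}
  (d : visual_metric X) : Type := boundary X.

HB.instance Definition _ (R : realType) (X : metricType R)
  (d : visual_metric X) := gen_eqMixin (visual_boundary d).
HB.instance Definition _ (R : realType) (X : metricType R)
  (d : visual_metric X) := gen_choiceMixin (visual_boundary d).
HB.instance Definition _ (R : realType) (X : metricType R)
    (d : visual_metric X) :=
  @isMetric.Build R (visual_boundary d) (vdist d) (vdistxx d)
    (@vdist_positivity _ _ d) (vdist_sym d) (vdist_triangle d).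

Section RandomEmbeddings.
Context {R : realType}.

Definition random_map {disp} {Omega : measurableType disp}
    (P : probability Omega R) (X Y : metricType R) (x0 : X) (y0 : Y)
    (phi : Omega -> X -> Y) : Prop :=
  [/\ forall (x : X) (B : set Y), <<s @open Y >> B ->
        measurable [set w | B (phi w x)],
      forall x : X, exists S : set Y,
        separable_set S /\ {ae P, forall w, S (phi w x)} &
      {ae P, forall w, phi w x0 = y0}].

Definition stochastic_biLipschitz_embeds
    (X Y : metricType R) (x0 : X) (y0 : Y) : Prop :=
  exists (disp : measure_display) (Omega : measurableType disp)
         (P : probability Omega R) (phi : Omega -> X -> Y),
    random_map P x0 y0 phi /\
    exists D s : R, [/\ 0 < D, 0 < s & forall x y : X,
      {ae P, forall w, s * mdist x y <= mdist (phi w x) (phi w y)} /\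
      ('E_P[fun w => mdist (phi w x) (phi w y)] <= (s * D * mdist x y)%:E)%E].

(* [lne] sends 0 to -oo.  The lower bound makes the negative part of the
   logarithm integrable when x <> y, so the integral is never of the
   indeterminate form +oo - oo. *)
Definition log_stochastic_biLipschitz_embeds
    (X Y : metricType R) (x0 : X) (y0 : Y) : Prop :=
  exists (disp : measure_display) (Omega : measurableType disp)
         (P : probability Omega R) (phi : Omega -> X -> Y),
    random_map P x0 y0 phi /\
    exists D s : R, [/\ 0 < D, 0 < s & forall x y : X,
      {ae P, forall w, s * mdist x y <= mdist (phi w x) (phi w y)} /\
      (\int[P]_w lne (mdist (phi w x) (phi w y))%:E
         <= lne (s * D * mdist x y)%:E)%E].

End RandomEmbeddings.

Definition isomorphic {R : realType} (V W : normedModType R) : Prop :=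
  exists (f : {linear V -> W}) (g : {linear W -> V}),
    [/\ continuous f, continuous g, cancel f g & cancel g f].

Section Dual.
Context {R : realType} (V : normedModType R).

Definition dual_pred : {pred V -> R^o} :=
  [pred phi | `[< linear phi /\ continuous phi >]].

Lemma dual_pred_submod : submod_closed dual_pred.
Proof.
split=> [|a f g].
  apply/asboolP; split; last exact: cst_continuous.
  by move=> a u v; rewrite /= scaler0 addr0.
move=> /asboolP[lf cf] /asboolP[lg cg]; apply/asboolP; split.
  move=> b u v; rewrite /= !fctE lf lg !scalerDr !scalerA [b * a]mulrC.
  by rewrite addrACA.
by move=> x; apply: cvgD; [apply: cvgZr; exact: cf|exact: cg].
Qed.

HB.instance Definition _ :=
  GRing.isSubmodClosed.Build R _ dual_pred dual_pred_submod.

Record dual : Type :=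
  Dual { dual_fun :> V -> R^o ; dual_mem : dual_fun \in dual_pred }.
HB.instance Definition _ := [isSub for dual_fun].
HB.instance Definition _ := [Choice of dual by <:].
HB.instance Definition _ := [SubChoice_isSubLmodule of dual by <:].

Definition dual_norm (phi : dual) : R :=
  sup [set `|phi v| | v in [set v : V | `|v| <= 1]].

Lemma dual_bounded (phi : dual) : exists M, forall v, `|phi v| <= M * `|v|.
Proof.
have /asboolP[lphi cphi] := dual_mem phi.
pose F : {linear V -> R^o} :=
  HB.pack (phi : V -> R^o) (GRing.isLinear.Build R V R^o *:%R phi lphi).
have /linear_boundedP : bounded_near F (nbhs (0 : V)).
  by apply: continuous_linear_bounded; exact: cphi.
by move=> /pinfty_ex_gt0[M _ FM]; exists M.
Qed.

Lemma dual_funZ (phi : dual) a v : phi (a *: v) = a * phi v.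
Proof.
have /asboolP[lphi _] := dual_mem phi.
have phi0 : phi 0 = 0.
  by have := lphi (-1) 0 0; rewrite scaleN1r oppr0 addr0 scaleN1r addNr.
by have := lphi a v 0; rewrite !addr0 phi0 addr0.
Qed.

Lemma dual_norm_le (phi : dual) M :
  (forall v, `|v| <= 1 -> `|phi v| <= M) -> dual_norm phi <= M.
Proof.
move=> phiM; apply: ge_sup; first by exists `|phi 0|, 0; rewrite //= normr0.
by move=> _ [v /= v1 <-]; exact: phiM.
Qed.

Lemma le_dual_norm1 (phi : dual) v : `|v| <= 1 -> `|phi v| <= dual_norm phi.
Proof.
move=> v1; apply: ub_le_sup; last by exists v.
have [M phiM] := dual_bounded phi; exists `|M| => _ [u /= u1 <-].
apply: (le_trans (phiM u)); rewrite (le_trans (ler_norm _))// normrM normr_id.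
by rewrite ler_piMr.
Qed.

Lemma dual_norm_ge0 (phi : dual) : 0 <= dual_norm phi.
Proof. by apply: le_trans (le_dual_norm1 phi (v := 0) _); rewrite // normr0. Qed.

Lemma dual_normD (phi psi : dual) :
  dual_norm (phi + psi) <= dual_norm phi + dual_norm psi.
Proof.
apply: dual_norm_le => v v1.
have -> : (phi + psi : dual) v = phi v + psi v by [].
by rewrite (le_trans (ler_normD _ _))// lerD// le_dual_norm1.
Qed.

Lemma dual_normZ_le (l : R) (phi : dual) :
  dual_norm (l *: phi) <= `|l| * dual_norm phi.
Proof.
apply: dual_norm_le => v v1.
have -> : (l *: phi : dual) v = l * phi v by [].
by rewrite normrM ler_wpM2l// le_dual_norm1.
Qed.

Lemma dual_normZ (l : R) (phi : dual) :
  dual_norm (l *: phi) = `|l| * dual_norm phi.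
Proof.
apply/eqP; rewrite eq_le dual_normZ_le/=.
have [->|l0] := eqVneq l 0; first by rewrite normr0 mul0r dual_norm_ge0.
rewrite mulrC -ler_pdivlMr ?normr_gt0// mulrC -normfV.
by have := dual_normZ_le l^-1 (l *: phi); rewrite scalerA mulVf// scale1r.
Qed.

Lemma dual_norm0_eq0 (phi : dual) : dual_norm phi = 0 -> phi = 0.
Proof.
move=> phi0; apply: val_inj; apply/funext => v /=.
have [->|v0] := eqVneq v 0.
  by have := dual_funZ phi 0 0; rewrite scale0r mul0r.
have := @le_dual_norm1 phi (`|v|^-1 *: v).
rewrite normrZ normfV normr_id mulVf ?normr_eq0// lexx phi0 => /(_ isT).
rewrite dual_funZ normr_le0 mulf_eq0 invr_eq0 normr_eq0 (negbTE v0)/=.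
by move/eqP.
Qed.

HB.instance Definition _ := @Lmodule_isNormed.Build R dual dual_norm
  dual_normD dual_normZ dual_norm0_eq0.

End Dual.

Section Lip0.
Context {R : realType} (A : metricType R) (a0 : A).

Definition lipschitz_with (f : A -> R) (L : R) : Prop :=
  0 <= L /\ forall x y, `|f x - f y| <= L * mdist x y.

Definition lip0_pred : {pred A -> R^o} :=
  [pred f | `[< f a0 = 0 /\ exists L, lipschitz_with f L >]].

Lemma lip0_pred_submod : submod_closed lip0_pred.
Proof.
split=> [|a f g].
  apply/asboolP; split=> //; exists 0; split=> // x y.
  by rewrite /= subrr normr0 mul0r.
move=> /asboolP[f0 [L [L0 fL]]] /asboolP[g0 [M [M0 gM]]]; apply/asboolP; split.
  by rewrite !fctE f0 g0 scaler0 addr0.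
exists (`|a| * L + M); split; first by rewrite addr_ge0// mulr_ge0.
move=> x y; rewrite !fctE opprD addrACA -scalerBr mulrDl.
rewrite (le_trans (ler_normD _ _))// lerD// normrM -mulrA.
by rewrite ler_wpM2l.
Qed.

HB.instance Definition _ :=
  GRing.isSubmodClosed.Build R _ lip0_pred lip0_pred_submod.

Record Lip0 : Type :=
  MkLip0 { lip0_fun :> A -> R^o ; lip0_mem : lip0_fun \in lip0_pred }.
HB.instance Definition _ := [isSub for lip0_fun].
HB.instance Definition _ := [Choice of Lip0 by <:].
HB.instance Definition _ := [SubChoice_isSubLmodule of Lip0 by <:].

Definition lip_norm (f : Lip0) : R := inf (lipschitz_with f).

Lemma lip_normP (f : Lip0) : lipschitz_with f (lip_norm f).
Proof.
have /asboolP[_ neq0] := lip0_mem f.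
split=> [|x y]; first by apply: lb_le_inf => // L [].
have [<-|xy] := eqVneq x y; first by rewrite subrr normr0 mdistxx mulr0.
rewrite -ler_pdivrMr ?mdist_gt0//; apply: lb_le_inf => // L [_ fL].
by rewrite ler_pdivrMr ?mdist_gt0.
Qed.

Lemma lip_norm_le (f : Lip0) L : lipschitz_with f L -> lip_norm f <= L.
Proof. by move=> fL; apply: ge_inf => //; exists 0 => M []. Qed.

Lemma lip_normD (f g : Lip0) : lip_norm (f + g) <= lip_norm f + lip_norm g.
Proof.
have [f0 fL] := lip_normP f; have [g0 gL] := lip_normP g.
apply: lip_norm_le; split=> [|x y]; first exact: addr_ge0.
have E z : (f + g : Lip0) z = f z + g z by [].
by rewrite !E opprD addrACA mulrDl (le_trans (ler_normD _ _))// lerD.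
Qed.

Lemma lip_normZ_le (l : R) (f : Lip0) : lip_norm (l *: f) <= `|l| * lip_norm f.
Proof.
have [f0 fL] := lip_normP f.
apply: lip_norm_le; split=> [|x y]; first exact: mulr_ge0.
have E z : (l *: f : Lip0) z = l * f z by [].
by rewrite !E -mulrBr normrM -mulrA ler_wpM2l.
Qed.

Lemma lip_normZ (l : R) (f : Lip0) : lip_norm (l *: f) = `|l| * lip_norm f.
Proof.
apply/eqP; rewrite eq_le lip_normZ_le/=.
have [->|l0] := eqVneq l 0.
  by rewrite normr0 mul0r; have [] := lip_normP (0 *: f).
rewrite mulrC -ler_pdivlMr ?normr_gt0// mulrC -normfV.
by have := lip_normZ_le l^-1 (l *: f); rewrite scalerA mulVf// scale1r.
Qed.

Lemma lip_norm0_eq0 (f : Lip0) : lip_norm f = 0 -> f = 0.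
Proof.
move=> fn0; apply: val_inj; apply/funext => x /=.
have /asboolP[fa0 _] := lip0_mem f; have [_ /(_ x a0)] := lip_normP f.
by rewrite fn0 mul0r fa0 subr0 normr_le0 => /eqP.
Qed.

HB.instance Definition _ := @Lmodule_isNormed.Build R Lip0 lip_norm
  lip_normD lip_normZ lip_norm0_eq0.

Lemma eval_dual_pred (x : A) : (fun f : Lip0 => f x) \in @dual_pred R Lip0.
Proof.
have lin : linear (fun f : Lip0 => f x : R^o) by [].
apply/asboolP; split=> //.
pose F : {linear Lip0 -> R^o} := HB.pack (fun f : Lip0 => f x : R^o)
  (GRing.isLinear.Build R Lip0 R^o *:%R _ lin).
apply: (@bounded_linear_continuous R Lip0 R^o F).
apply/linear_boundedP; near=> M => f.
have [f0 /(_ x a0)] := lip_normP f; have /asboolP[-> _] := lip0_mem f.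
rewrite subr0 => /le_trans; apply; rewrite mulrC; apply: ler_wpM2r; first exact: f0.
near: M; apply: nbhs_pinfty_ge; exact: num_real.
Unshelve. all: by end_near. Qed.

Definition eval_dual (x : A) : dual Lip0 := Dual (eval_dual_pred x).

End Lip0.

Section ClosedSpan.
Context {R : realType} (V : normedModType R) (S : set V).

Definition lin_span : set V :=
  [set v | exists (n : nat) (c : 'I_n -> R) (u : 'I_n -> V),
     (forall i, S (u i)) /\ v = \sum_(i < n) c i *: u i].

Definition closed_span_pred : {pred V} := [pred v | `[< closure lin_span v >]].

Lemma lin_span0 : lin_span 0.
Proof.
exists 0%N, (fun=> 0), (fun=> 0); split; first by case.
by rewrite big_ord0.
Qed.

Lemma lin_spanP a u v : lin_span u -> lin_span v -> lin_span (a *: u + v).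
Proof.
move=> [n [c [f [Sf ->]]]] [m [d [g [Sg ->]]]].
exists (n + m)%N, 
  (fun i : 'I_(n + m) => match fintype.split i with inl j => a * c j | inr j => d j end),
  (fun i : 'I_(n + m) => match fintype.split i with inl j => f j | inr j => g j end); split.
  by move=> i; case: fintype.split.
rewrite big_split_ord/= scaler_sumr; congr (_ + _); apply: eq_bigr => i _.
  by rewrite (unsplitK (inl i)) scalerA.
by rewrite (unsplitK (inr i)).
Qed.

Lemma closed_span_submod : submod_closed closed_span_pred.
Proof.
split=> [|a u v].
  by apply/asboolP; apply: subset_closure; exact: lin_span0.
move=> /asboolP cu /asboolP cv; apply/asboolP.
have approx w e : closure lin_span w -> 0 < e ->
    exists2 s, lin_span s & `|w - s| < e.
  move=> cw e0; have [s [ss]] := cw _ (nbhsx_ballx w e e0).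
  by rewrite -ball_normE => ws; exists s.
move=> B /nbhs_ballP[e /= e0 eB].
have a1 : 0 < `|a| + 1 by rewrite ltr_wpDl.
have [s ss us] := approx _ _ cu (divr_gt0 (divr_gt0 e0 (ltr0Sn R 1)) a1).
have [t st vt] := approx _ _ cv (divr_gt0 e0 (ltr0Sn R 1)).
exists (a *: s + t); split; first exact: lin_spanP.
apply: eB; rewrite -ball_normE /ball_/= opprD addrACA -scalerBr.
rewrite (le_lt_trans (ler_normD _ _))// [e]splitr ltr_leD// ?ltW//.
rewrite normrZ; move: us; rewrite ltr_pdivlMr// => /(le_lt_trans _); apply.
by rewrite mulrC ler_wpM2l// lerDl.
Qed.

HB.instance Definition _ :=
  GRing.isSubmodClosed.Build R _ closed_span_pred closed_span_submod.

Record closed_span : Type := MkClosedSpan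
  { closed_span_val :> V ; closed_span_mem : closed_span_val \in closed_span_pred }.
HB.instance Definition _ := [isSub for closed_span_val].
HB.instance Definition _ := [Choice of closed_span by <:].
HB.instance Definition _ := [SubChoice_isSubLmodule of closed_span by <:].

Definition closed_span_norm (v : closed_span) : R := `|closed_span_val v|.

Lemma closed_span_normD (u v : closed_span) :
  closed_span_norm (u + v) <= closed_span_norm u + closed_span_norm v.
Proof. exact: ler_normD. Qed.

Lemma closed_span_normZ (l : R) (v : closed_span) :
  closed_span_norm (l *: v) = `|l| * closed_span_norm v.
Proof. exact: normrZ. Qed.

Lemma closed_span_norm0_eq0 (v : closed_span) : closed_span_norm v = 0 -> v = 0.
Proof. by move=> /normr0_eq0 v0; exact: val_inj. Qed.

HB.instance Definition _ := @Lmodule_isNormed.Build R closed_span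
  closed_span_norm closed_span_normD closed_span_normZ closed_span_norm0_eq0.

End ClosedSpan.

Definition LF {R : realType} {A : metricType R} (a0 : A) : normedModType R :=
  closed_span (range (@eval_dual R A a0)).

Section Ell1.
Context {R : realType}.

Definition ell1_pred : {pred nat -> R^o} :=
  [pred u | `[< cvgn (series (fun n => `|u n|) : R^nat) >]].

Lemma ell1_pred_submod : submod_closed ell1_pred.
Proof.
split=> [|a u v].
  apply/asboolP => /=.
  rewrite (_ : series _ = cst 0); first exact: is_cvg_cst.
  by apply/funext => n; rewrite seriesEnat /= big1// => i _; rewrite normr0.
move=> /asboolP cu /asboolP cv; apply/asboolP => /=.
have cauv : cvgn (series (`|a| *: (fun n => `|u n|) + (fun n => `|v n|))).
  by apply: is_cvg_seriesD => //; exact: is_cvg_seriesZ.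
apply: series_le_cvg cauv => n //=; first by rewrite addr_ge0// mulr_ge0.
by rewrite (le_trans (ler_normD _ _))// lerD// normrM.
Qed.

HB.instance Definition _ :=
  GRing.isSubmodClosed.Build R _ ell1_pred ell1_pred_submod.

Record ell1 : Type :=
  MkEll1 { ell1_fun :> nat -> R^o ; ell1_mem : ell1_fun \in ell1_pred }.
HB.instance Definition _ := [isSub for ell1_fun].
HB.instance Definition _ := [Choice of ell1 by <:].
HB.instance Definition _ := [SubChoice_isSubLmodule of ell1 by <:].

Definition ell1_norm (u : ell1) : R := limn (series (fun n => `|u n|) : R^nat).

Lemma ell1_cvg (u : ell1) : cvgn (series (fun n => `|u n|) : R^nat).
Proof. exact/asboolP/(ell1_mem u). Qed.

Lemma ell1_normD (u v : ell1) : ell1_norm (u + v) <= ell1_norm u + ell1_norm v.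
Proof.
rewrite /ell1_norm -lim_seriesD; [|exact: ell1_cvg..].
apply: lim_series_le; first exact: ell1_cvg.
  by apply: is_cvg_seriesD; exact: ell1_cvg.
by move=> n; exact: ler_normD.
Qed.

Lemma ell1_normZ (l : R) (u : ell1) : ell1_norm (l *: u) = `|l| * ell1_norm u.
Proof.
rewrite /ell1_norm -[RHS]lim_seriesZ; last exact: ell1_cvg.
congr (limn (series _)); apply/funext => n; exact: normrM.
Qed.

Lemma ell1_norm0_eq0 (u : ell1) : ell1_norm u = 0 -> u = 0.
Proof.
move=> u0; apply: val_inj; apply/funext => n /=.
have ndu : nondecreasing_seq (series (fun n => `|u n|)).
  by apply/nondecreasing_seqP => m; rewrite -subr_ge0 seriesSB.
have := nondecreasing_cvgn_le ndu (@ell1_cvg u) n.+1.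
rewrite -/(ell1_norm u) u0 seriesSr => un0; apply/normr0_eq0/eqP.
rewrite eq_le normr_ge0 andbT (le_trans _ un0)// lerDr.
by rewrite /series/= sumr_ge0.
Qed.

HB.instance Definition _ := @Lmodule_isNormed.Build R ell1
  ell1_norm ell1_normD ell1_normZ ell1_norm0_eq0.

End Ell1.
Arguments ell1 R : clear implicits.

(* Main.v *)
Require Import Defs.
From HB Require Import structures.
From mathcomp Require Import all_boot all_order all_algebra.
From mathcomp Require Import all_classical all_reals all_analysis.
From mathcomp Require Import measurable_realfun.
From mathcomp Require Import zify ring lra.

Set Implicit Arguments.
Unset Strict Implicit.
Unset Printing Implicit Defensive.

Import Order.TTheory GRing.Theory Num.Theory.
Import numFieldNormedType.Exports.

Local Open Scope classical_set_scope.
Local Open Scope ring_scope.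

(** Seen from a base point [o], a visual hyperbolic space is a tree up to
    bounded errors: a point [x] is coded by its height, the distance to [o],
    and by the end [xi x] of a rough ray through it, and the Gromov product of
    [x] and [y] is the least of the two heights and of the Gromov product of
    [xi x] and [xi y] ([boundary_shadow]).  Now replace the visual metric, of
    order [expR (- eps * product)], by the random ultrametric [u] provided by
    the embedding of the boundary.  The balls of radii [B * expR (- eps * n)]
    form a genuine tree, in which two points part at [parting_level].  Because
    [u] never contracts, this tree is almost surely at least as large as [A];
    because levels are logarithms of [u], the bound on the expected logarithm
    says that on average it is larger by a constant only
    ([expected_split_length]).  Additive constants do not matter, since [A] is
    uniformly discrete.

    Both conclusions are then read off one object, a random tree whose
    vertices are the points of [A] themselves ([random_walks]).  It is obtained
    by deleting the Steiner points of the tree of balls: going down a branch,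
    one keeps the current representative point of [A] as long as it is about
    as close to the branch as the nearest point below, and otherwise moves to
    the latter.  The distance to the representative is a potential which pays
    for the moves, so that walks are lengthened by a bounded factor only
    ([rep_step], [branch_dist]).  The walk from the root to [a] depends on
    finitely many points because [A] is locally finite; it is therefore a
    random variable with finitely many values, and no measurability question
    is left ([eq_branch], [finite_rv]).

    For the first conclusion, all finite walks from [a0] are the branches of
    one fixed R-tree, and a point is sent to the end of its random walk
    ([random_walks_Rtree]).

    For the second one, the evaluation at [a] is the sum of the differences of
    evaluations along the walk to [a].  Taking expectations, it becomes a
    combination of the normalized differences over all pairs of points, whose
    coefficients are the expected flows of the walk; this factors the identity
    of [LF a0] through [ell1] ([synthesis_analysis], [random_walks_ell1]).
    Conversely, bump functions around points that go to infinity fast enough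
    exhibit [ell1] as a complemented subspace of [LF a0]
    ([bump_biorthogonal]).  Pelczynski's decomposition method turns these two
    complementations into an isomorphism ([pelczynski]). *)

(** * Walks, and the removal of Steiner points from a tree *)

Section Walks.
Context {R : realType} {A : metricType R}.
Implicit Types (x y : A) (p q r : seq A).

Fixpoint walk_length x p : R :=
  if p is y :: p' then mdist x y + walk_length y p' else 0.

Fixpoint common_prefix p q : seq A :=
  if p is x :: p' then
    if q is y :: q' then if x == y then x :: common_prefix p' q' else [::]
    else [::]
  else [::].

Lemma walk_length_ge0 x p : 0 <= walk_length x p.
Proof. by elim: p x => //= y p IH x; rewrite addr_ge0 ?mdist_ge0. Qed.

Lemma walk_length_cat x p q :
  walk_length x (p ++ q) = walk_length x p + walk_length (last x p) q.
Proof. by elim: p x => [x|y p IH x] /=; rewrite ?add0r// IH addrA. Qed.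

Lemma mdist_last_le x p : mdist x (last x p) <= walk_length x p.
Proof.
elim: p x => [x|y p IH x] /=; first by rewrite mdistxx.
by rewrite (le_trans (metric_triangle _ y _))// lerD2l.
Qed.

Lemma common_prefix_cat p q r :
  common_prefix (p ++ q) (p ++ r) = p ++ common_prefix q r.
Proof. by elim: p => //= x p ->; rewrite eqxx. Qed.

Lemma common_prefixC p q : common_prefix p q = common_prefix q p.
Proof.
elim: p q => [|x p IH] [|y q]//=.
by rewrite eq_sym; case: eqVneq => [->|//]; rewrite IH.
Qed.

Lemma common_prefixP p q : exists p' q',
  p = common_prefix p q ++ p' /\ q = common_prefix p q ++ q'.
Proof.
elim: p q => [|x p IH] [|y q] /=.
- by exists [::], [::].
- by exists [::], (y :: q).
- by exists (x :: p), [::].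
case: eqVneq => [<-|_]; last by exists (x :: p), (y :: q).
have [p' [q' [pE qE]]] := IH q.
by exists p', q'; rewrite /= -pE -qE.
Qed.

Variable x0 : A.

(** The Gromov product, based at the empty walk, of the endpoints of two
    walks in the tree of all walks issued from [x0]. *)
Definition walk_prod p q : R := walk_length x0 (common_prefix p q).

Definition walk_dist p q : R :=
  walk_length x0 p + walk_length x0 q - 2 * walk_prod p q.

Lemma walk_prodC p q : walk_prod p q = walk_prod q p.
Proof. by rewrite /walk_prod common_prefixC. Qed.

Lemma walk_prod_ge0 p q : 0 <= walk_prod p q.
Proof. exact: walk_length_ge0. Qed.

Lemma walk_prodxx p : walk_prod p p = walk_length x0 p.
Proof.
by rewrite /walk_prod -[X in common_prefix X X]cats0 common_prefix_cat/= cats0.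
Qed.

Lemma walk_prod_le p q : walk_prod p q <= walk_prod p p.
Proof.
rewrite walk_prodxx; have [p' [q' [pE _]]] := common_prefixP p q.
by rewrite {2}pE walk_length_cat lerDl walk_length_ge0.
Qed.

(** Two prefixes of the walk [q] are comparable, and their lengths are the two
    Gromov products on the left. *)
Lemma walk_prod_ultra p q r :
  Num.min (walk_prod p q) (walk_prod q r) <= walk_prod p r.
Proof.
rewrite /walk_prod; elim: q x0 p r => [|y q IH] x p r.
  by rewrite common_prefixC ge_min walk_length_ge0.
case: p r => [|z p] [|t r] /=; try by rewrite ge_min lexx ?orbT.
have [->|zy] /= := eqVneq z y; last by rewrite ge_min walk_length_ge0.
have [->|yt] /= := eqVneq y t; last by rewrite ge_min lexx orbT.
by rewrite -addr_minr lerD2l.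
Qed.

Lemma walk_dist_tails p q r :
  walk_dist (p ++ q) (p ++ r) <=
  walk_length (last x0 p) q + walk_length (last x0 p) r.
Proof.
rewrite /walk_dist /walk_prod common_prefix_cat !walk_length_cat.
by have := walk_length_ge0 (last x0 p) (common_prefix q r); lra.
Qed.

Lemma walk_dist_eq p q : exists c p' q', [/\ p = c ++ p', q = c ++ q' &
    walk_dist p q = walk_length (last x0 c) p' + walk_length (last x0 c) q'].
Proof.
have [p' [q' [pE qE]]] := common_prefixP p q.
exists (common_prefix p q), p', q'; split => //.
rewrite /walk_dist /walk_prod; move: (common_prefix p q) pE qE => c -> ->.
by rewrite !walk_length_cat; ring.
Qed.

Lemma mdist_last_walk_dist p q :
  mdist (last x0 p) (last x0 q) <= walk_dist p q.
Proof.
have [c [p' [q' [pE qE ->]]]] := walk_dist_eq p q.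
rewrite pE qE !last_cat (le_trans (metric_triangle _ (last x0 c) _))//.
by rewrite metric_sym lerD// mdist_last_le.
Qed.

End Walks.

Section SteinerPointRemoval.
Context {R : realType} {A : metricType R} (a0 : A) (h : A -> nat).
Implicit Types (lev : A -> A -> nat) (a b c : A) (i j m : nat).

(** [lev a b] stands for the level of the last common node of the branches of
    [a] and [b] in a rooted tree with unit edges, where the branch of [a] has
    length [h a].  Nodes are not a type of their own: the node of level [i] on
    the branch of [a] is written [(a, i)], and it is also the node [(b, i)]
    when [i <= lev a b]. *)
Definition tree_profile lev :=
  [/\ forall a b, lev a b = lev b a, forall a, lev a a = h a,
      forall a b, (lev a b <= h a)%N &
      forall a b c, (minn (lev a b) (lev b c) <= lev a c)%N].

(** The distance in the tree from the node [(a, i)] to the end of the branch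
    of [b]. *)
Definition node_dist lev a i b : nat := (i + h b - (minn i (lev a b)).*2)%N.

(** A point of least height below the node [(a, i)].  It is chosen from a set
    which is the same for all branches through the node, so it depends on the
    node only. *)
Definition nearest lev a i : A :=
  xget a0 [set b | (i <= lev a b)%N /\
                   forall c, (i <= lev a c)%N -> (h b <= h c)%N].

(** The representative of the node [(a, i)] is inherited from the level above
    until it gets more than three times as far as the nearest point below.
    Always taking the nearest point would be too costly: it may change at
    each level at a price comparable to the whole remaining branch. *)
Fixpoint rep lev a i : A :=
  if i is j.+1 then
    if (node_dist lev a i (rep lev a j) <= 3 * (h (nearest lev a i) - i))%N
    then rep lev a j else nearest lev a i
  else a0.

Definition branch lev a : seq A := rcons [seq rep lev a i | i <- iota 1 (h a)] a.

Section Fixed.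
Context (lev : A -> A -> nat) (levP : tree_profile lev) (ha0 : h a0 = 0%N).

Let levC a b : lev a b = lev b a. Proof. by case: levP. Qed.
Let levxx a : lev a a = h a. Proof. by case: levP. Qed.
Let lev_le a b : (lev a b <= h a)%N. Proof. by case: levP. Qed.
Let lev_ultra a b c : (minn (lev a b) (lev b c) <= lev a c)%N.
Proof. by case: levP. Qed.
Let lev_le2 a b : (lev a b <= h b)%N. Proof. by rewrite levC. Qed.

Lemma nearestP a i : (i <= h a)%N ->
  (i <= lev a (nearest lev a i))%N /\
  forall c, (i <= lev a c)%N -> (h (nearest lev a i) <= h c)%N.
Proof.
move=> ia; rewrite /nearest; case: xgetP => [b -> //|noneP]; exfalso.
pose P n := `[< exists2 b, (i <= lev a b)%N & h b = n >].
have exP : exists n, P n by exists (h a); apply/asboolP; exists a; rewrite ?levxx.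
case: (ex_minnP exP) => n /asboolP[b ib <-] minb.
apply: (noneP b); split => // c ic; apply: minb; apply/asboolP.
by exists c.
Qed.

Lemma nearest_eq a b i : (i <= lev a b)%N -> nearest lev a i = nearest lev b i.
Proof.
move=> iab; have E c : (i <= lev a c)%N = (i <= lev b c)%N.
  have := lev_ultra a b c; have := lev_ultra b a c; rewrite (levC b a).
  by move: iab; lia.
congr (xget _ _); apply/funext => c; apply/propext; rewrite /= E.
by split=> -[-> H]; split=> // ? ?; apply: H; rewrite ?E// -E.
Qed.

Lemma node_dist_eq a b i c : (i <= lev a b)%N ->
  node_dist lev a i c = node_dist lev b i c.
Proof.
move=> iab; rewrite /node_dist; congr (_ - _.*2)%N.
by have := lev_ultra a b c; have := lev_ultra b a c; rewrite (levC b a); lia.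
Qed.

Lemma rep_eq a b i : (i <= lev a b)%N -> rep lev a i = rep lev b i.
Proof.
elim: i => //= i IH iab; rewrite IH ?(ltnW iab)//.
by rewrite (node_dist_eq _ iab) (nearest_eq iab).
Qed.

Lemma node_dist_nearest a i : (i <= h a)%N ->
  node_dist lev a i (nearest lev a i) = (h (nearest lev a i) - i)%N.
Proof. by move=> /nearestP[+ _]; rewrite /node_dist; lia. Qed.

Lemma node_dist_rep a i : (i <= h a)%N ->
  (node_dist lev a i (rep lev a i) <= 3 * (h a - i))%N.
Proof.
case: i => [|i ia]; first by rewrite /node_dist ha0 min0n.
have [_ /(_ a)] := nearestP ia; rewrite levxx => /(_ ia) le_near /=.
case: ifP => [/leq_trans|_]; first by apply; lia.
by rewrite node_dist_nearest//; lia.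
Qed.

Section Metric.
Context (L K : R) (L0 : 0 <= L) (K0 : 0 <= K).
Hypothesis profile_dist : forall a b,
  mdist a b <= L * (h a + h b - (lev a b).*2)%N%:R + K.

Local Notation C := (2 * L + K).

(** The distance from the node to its representative is a potential: it grows
    by at most one when the level increases, and a change of representative
    makes it drop by a definite proportion of the price of the change. *)
Lemma rep_step a i : (i < h a)%N ->
  mdist (rep lev a i) (rep lev a i.+1) <=
  C * ((node_dist lev a i (rep lev a i)).+1%:R -
       (node_dist lev a i.+1 (rep lev a i.+1))%:R).
Proof.
move=> ia; have C0 : 0 <= C by move: L0 K0; lra.
have le_step : (node_dist lev a i.+1 (rep lev a i) <=
                (node_dist lev a i (rep lev a i)).+1)%N.
  by have := lev_le2 a (rep lev a i); rewrite /node_dist; lia.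
rewrite /=; case: ifP => [_|/negbT].
  by rewrite mdistxx mulr_ge0// subr_ge0 ler_nat.
rewrite -ltnNge node_dist_nearest//.
set b := rep lev a i in le_step *; set c := nearest lev a i.+1.
set r := node_dist lev a i.+1 b in le_step *; set s := (h c - i.+1)%N => rs.
have := profile_dist b c.
have [ic _] := nearestP ia.
have : (h b + h c - (lev b c).*2 <= r + s)%N.
  have := lev_ultra b a c; rewrite /r /s /node_dist (levC b a).
  have := lev_le2 a b; have := lev_le2 a c; rewrite -/c in ic; lia.
move: (h b + h c - _)%N => t ts le1; apply: (le_trans le1).
move: r s (node_dist lev a i b) rs ts le_step {le1 ic} => r s r' rs ts le_step.
have /(ler_wpM2l L0) : t%:R <= r%:R + s%:R :> R by rewrite -natrD ler_nat.
have : 3 * s%:R + 1 <= r%:R :> R by rewrite -natrM natr1 ler_nat.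
have : r%:R <= r'.+1%:R :> R by rewrite ler_nat.
have : 0 <= s%:R :> R by [].
move: L0 K0 (t%:R) (s%:R) (r%:R) (r'.+1%:R) => L0' K0' t' s' q q' s0 rs' qq' le1.
(* The change costs [L * (r + s) + K]; as [r > 3 * s], the sum [r + s] is at
   most [2 * (r - s)], and [r - s >= 1] absorbs [K]. *)
apply: (@le_trans _ _ (C * (q - s'))); last by rewrite ler_wpM2l//; lra.
by nra.
Qed.

(** The potential telescopes along the branch, and it starts at no more than
    three times the remaining length ([node_dist_rep]). *)
Lemma branch_tail a m : (m <= h a)%N ->
  walk_length (rep lev a m) (rcons [seq rep lev a i | i <- iota m.+1 (h a - m)] a)
  <= 4 * C * (h a - m)%:R + K.
Proof.
move=> ma; have C0 : 0 <= C by move: L0 K0; lra.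
suff: walk_length (rep lev a m)
     (rcons [seq rep lev a i | i <- iota m.+1 (h a - m)] a) <=
    C * ((node_dist lev a m (rep lev a m))%:R + (h a - m)%:R) + K.
  move=> /le_trans; apply; rewrite lerD2r [4 * _]mulrC -mulrA.
  rewrite ler_wpM2l//; have := node_dist_rep ma.
  rewrite -(ler_nat R) natrM.
  by move: (node_dist _ _ _ _) (h a - m)%N => r n; lra.
have [n] := ubnP (h a - m)%N; elim: n m ma => // n IH m ma nm.
have [E|mlt] := leqP (h a) m.
  have {E}-> : m = h a by lia.
  rewrite subnn /= !addr0.
  have := node_dist_rep (leqnn (h a)); rewrite subnn muln0 leqn0 => /eqP E.
  have := profile_dist (rep lev a (h a)) a.
  have -> : (h (rep lev a (h a)) + h a - (lev (rep lev a (h a)) a).*2 = 0)%N.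
    move: E; rewrite /node_dist levC; have := lev_le a (rep lev a (h a)); lia.
  by rewrite E !mulr0 add0r; nra.
have -> : (h a - m = (h a - m.+1).+1)%N by lia.
have step := rep_step mlt; rewrite [walk_length _ _]/=.
have := IH m.+1 mlt ltac:(lia).
rewrite -!natr1 in step *; set W := walk_length _ _; lra.
Qed.

Lemma branch_dist a b : walk_dist a0 (branch lev a) (branch lev b) <=
  4 * C * (h a + h b - (lev a b).*2)%N%:R + 2 * K.
Proof.
set m := lev a b.
pose pre := [seq rep lev a i | i <- iota 1 m].
pose tl c := rcons [seq rep lev c i | i <- iota m.+1 (h c - m)] c.
have split c : (m <= h c)%N ->
    (forall i, (i <= m)%N -> rep lev c i = rep lev a i) ->
    branch lev c = pre ++ tl c.
  move=> mc E; rewrite /branch -{1}(subnKC mc) iotaD add1n map_cat /tl rcons_cat.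
  by congr (_ ++ _); apply/eq_in_map => i; rewrite mem_iota => im; apply: E; lia.
have lastE : last a0 pre = rep lev a m.
  by rewrite /pre; case: (m) => // k; rewrite -{1}(addn1 k) iotaD map_cat last_cat add1n.
have mb : (m <= h b)%N by rewrite /m lev_le2.
have ma : (m <= h a)%N by rewrite /m lev_le.
have Eb i : (i <= m)%N -> rep lev b i = rep lev a i.
  by move=> im; apply/esym/rep_eq.
rewrite (split a ma (fun _ _ => erefl)) (split b mb Eb).
apply: (le_trans (walk_dist_tails _ _ _ _)); rewrite lastE.
have := branch_tail ma; have := branch_tail mb; rewrite Eb// -/(tl a) -/(tl b).
have -> : (h a + h b - m.*2 = (h a - m) + (h b - m))%N by lia.
by rewrite natrD; lra.
Qed.

End Metric.
End Fixed.

(** The nearest point below a node of the branch of [a] is at most as high as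
    [a], so all the points consulted along this branch have height at most
    [N].  This makes the branch a function of finitely many levels. *)
Lemma eq_branch lev lev' N a : tree_profile lev -> tree_profile lev' ->
  h a0 = 0%N -> (h a <= N)%N ->
  (forall b c, (h b <= N)%N -> (h c <= N)%N -> lev b c = lev' b c) ->
  branch lev a = branch lev' a.
Proof.
move=> levP levP' ha0 aN eqlev.
have near_le l : tree_profile l -> forall i, (i <= h a)%N -> (h (nearest l a i) <= h a)%N.
  move=> lP i ia; have [_ ->]// := nearestP lP ia.
  by case: lP => _ -> _ _.
have eqnear i : (i <= h a)%N -> nearest lev a i = nearest lev' a i.
  move=> ia; congr (xget _ _); apply/funext => b; apply/propext.
  have key l l' : tree_profile l -> tree_profile l' ->
     (forall b c, (h b <= N)%N -> (h c <= N)%N -> l b c = l' b c) ->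
     (i <= l a b)%N /\ (forall c, (i <= l a c)%N -> (h b <= h c)%N) ->
     (i <= l' a b)%N /\ (forall c, (i <= l' a c)%N -> (h b <= h c)%N).
    move=> lP lP' E [ib minb].
    have ba : (h b <= h a)%N by apply: minb; case: lP => _ ->.
    split; first by rewrite -E// (leq_trans ba).
    move=> c ic; have [cN|Nc] := leqP (h c) N; last by lia.
    by apply: minb; rewrite E.
  by split; apply: key => // ? ? ? ?; rewrite eqlev.
rewrite /branch; congr (rcons _ _).
have rep_le i : (i <= h a)%N -> (h (rep lev a i) <= N)%N.
  elim: i => [|i IH] ia /=; first by rewrite ha0.
  by case: ifP => _; [apply: IH; lia|rewrite (leq_trans (near_le _ levP _ ia))].
suff E i : (i <= h a)%N -> rep lev a i = rep lev' a i.
  by apply/eq_in_map => i; rewrite mem_iota => ia; apply: E; lia.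
elim: i => //= i IH ia; rewrite -IH ?(ltnW ia)// eqnear//.
by rewrite /node_dist eqlev// rep_le// ltnW.
Qed.

End SteinerPointRemoval.

(** * R-trees *)

Section FourPoint.
Context {R : realType} (T : metricType R).

(** Zero-hyperbolicity, in the form that does not single out a base point. *)
Definition four_point : Prop := forall x y z w : T,
  mdist x z + mdist y w <=
  Num.max (mdist x y + mdist z w) (mdist x w + mdist y z).

Definition geodesic_space : Prop :=
  forall x y : T, exists S, is_geodesic x y S.

Lemma open_disjoint_separated (U V : set T) :
  open U -> open V -> U `&` V = set0 -> separated U V.
Proof.
move=> oU oV UV; split; apply/eqP/negPn/negP => /set0P[x].
- move=> [/(_ V (open_nbhs_nbhs (conj oV _))) xU xV].
  by have := xU xV; rewrite UV => -[].
- move=> [xU] /(_ U (open_nbhs_nbhs (conj oU _))) => xV.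
  by have := xV xU; rewrite setIC UV => -[].
Qed.

Lemma closed_separated (U V C D : set T) : closed C -> closed D ->
  U `<=` C -> V `<=` D -> C `&` V = set0 -> U `&` D = set0 -> separated U V.
Proof.
move=> /closure_id cC /closure_id cD UC VD CV UD; split; rewrite -subset0 => x [].
  by move=> /(closure_subset UC); rewrite -cC => xC xV; rewrite -CV.
by move=> xU /(closure_subset VD); rewrite -cD => xD; rewrite -UD.
Qed.

Lemma isometry_within_continuous (f : R -> T) (a b : R) :
  {in `[a, b] &, forall s t, mdist (f s) (f t) = `|s - t|} ->
  {within `[a, b], continuous f}.
Proof.
move=> fiso; apply/subspace_continuousP => s sab.
apply/metricType_numDomainType.cvgrPdist_lt => e e0.
near=> t; rewrite fiso//; last by near: t; exact: withinT.
near: t; apply: cvg_within; exact: (nbhsx_ballx _ _ e0).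
Unshelve. all: by end_near. Qed.

Lemma continuous_mdist (x : T) : continuous (mdist x : T -> R).
Proof.
move=> y; apply/cvgrPdist_lt => e e0.
near=> z; have : mdist y z < e.
  by near: z; apply: metricType_numDomainType.cvgr_dist_lt.
move=> yz; rewrite ltr_norml.
have := metric_triangle x y z; have := metric_triangle x z y.
by rewrite (metric_sym z y); move: yz; lra.
Unshelve. all: by end_near. Qed.

Lemma geodesic_is_arc (x y : T) S : x <> y -> is_geodesic x y S -> is_arc x y S.
Proof.
move=> xy [f [f0 f1 fiso ->]].
have d0 : 0 < mdist x y by rewrite mdist_gt0; apply/eqP.
have itvP s : s \in `[0, 1] -> s * mdist x y \in `[0, mdist x y].
  rewrite !in_itv/= => /andP[s0 s1]; rewrite mulr_ge0 ?(ltW d0)//=.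
  by rewrite ler_piMl// ltW.
have giso : {in `[0, 1] &, forall s t,
    mdist (f (s * mdist x y)) (f (t * mdist x y)) = `|s - t| * mdist x y}.
  by move=> s t s01 t01; rewrite fiso ?itvP// -mulrBl normrM (gtr0_norm d0).
exists (fun s => f (s * mdist x y)); split.
- apply/subspace_continuousP => s s01.
  apply/metricType_numDomainType.cvgrPdist_lt => e e0.
  near=> t; rewrite giso//; last by near: t; exact: withinT.
  rewrite -ltr_pdivlMr//.
  near: t; apply: cvg_within; exact: (nbhsx_ballx _ _ (divr_gt0 e0 d0)).
- move=> s t s01 t01 /(congr1 (mdist (f (s * mdist x y)))).
  rewrite mdistxx giso// => /esym/eqP; rewrite mulf_eq0 (gt_eqF d0) orbF.
  by rewrite normr_eq0 subr_eq0 => /eqP.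
- by rewrite mul0r.
- by rewrite mul1r.
- apply/seteqP; split=> [_ [s sd <-]|_ [s s01 <-]]; last first.
    by exists (s * mdist x y) => //; exact: itvP.
  exists (s / mdist x y); last by rewrite /= divfK ?gt_eqF.
  move: sd; rewrite /= !in_itv/= => /andP[s0 sd].
  by rewrite divr_ge0 ?(ltW d0)//= ler_pdivrMr// mul1r.
Unshelve. all: by end_near. Qed.

Section Uniqueness.
Context (T4 : four_point) (x y : T) (S S' : set T).
Context (xy : x <> y) (geoS : is_geodesic x y S) (arcS' : is_arc x y S').

(** Removing a point [m] of the geodesic separates its endpoints: by the
    four-point condition, the points whose Gromov product with [x] at [m] is
    positive form an open and closed part of the complement of [m]. *)
Lemma geodesic_sub_arc : S `<=` S'.
Proof.
have [f [f0 f1 fiso ->]] := geoS; have [k [kc kinj k0 k1 S'E]] := arcS'.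
have d0 : 0 <= mdist x y by exact: mdist_ge0.
move=> _ [tau taud <-]; set m := f tau; apply: contrapT => mS'.
have xm : mdist x m = tau.
  rewrite -f0 /m fiso ?in_itv/= ?lexx//.
  by move: taud; rewrite /= in_itv/= => /andP[? ?]; rewrite sub0r normrN ger0_norm.
have my : mdist m y = mdist x y - tau.
  rewrite -{1}f1 /m fiso ?in_itv/= ?d0 ?lexx//.
  move: taud; rewrite /= in_itv/= => /andP[? ?].
  by rewrite distrC ger0_norm// subr_ge0.
have xS' : S' x by rewrite S'E; exists 0 => //=; rewrite in_itv/= lexx ler01.
have yS' : S' y by rewrite S'E; exists 1 => //=; rewrite in_itv/= lexx ler01.
have neq z : S' z -> 0 < mdist z m.
  by move=> zS'; rewrite mdist_gt0; apply/eqP => E; apply: mS'; rewrite -E.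
pose U := [set z | mdist x z < mdist x m + mdist m z].
pose V := [set z | mdist x m + mdist m z <= mdist x z /\ 0 < mdist z m].
have oU : open U.
  rewrite (_ : U = (fun z => mdist x m + mdist m z - mdist x z) @^-1` [set r | 0 < r]).
    apply: open_comp; last exact: open_gt.
    by move=> z _; apply: cvgB; [apply: cvgD; [exact: cvg_cst|]|]; exact: continuous_mdist.
  by apply/seteqP; split=> z; rewrite /U/= subr_gt0.
have oV : open V.
  rewrite openE => z [xz zm]; rewrite /interior.
  apply/metricType_numDomainType.nbhs_mdistP; exists (mdist z m) => //= z' zz'.
  have := metric_triangle z z' m; have := T4 x z' z m.
  move: xz zz'; rewrite /V/= (metric_sym z' z) (metric_sym m z) (metric_sym m z').
  by rewrite le_max => xz zz' /orP[|] h1 h2; split; move: xz zz' h1 h2; lra.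
have UV : U `&` V = set0.
  by rewrite -subset0 => z [+ [+ _]]; rewrite /U/= => /lt_le_trans /[apply]; rewrite ltxx.
have cS' : connected S'.
  rewrite S'E; apply: connected_continuous_connected => //.
  exact: segment_connected.
have S'UV : S' `<=` U `|` V.
  move=> z zS'; have [|] := ltP (mdist x z) (mdist x m + mdist m z); first by left.
  by right; split => //; exact: neq.
have [sub|sub] := connected_subset (open_disjoint_separated oU oV UV) S'UV cS'.
- by have := sub y yS'; rewrite /U/= xm my addrC subrK ltxx.
- have := sub x xS'; rewrite /V/= mdistxx => -[+ xm0].
  by move: xm0; rewrite (metric_sym m x); lra.
Qed.

(** A point [k s0] of the arc off the geodesic would cut the geodesic, which
    is contained in the arc, into its parts before and after time [s0]. *)
Lemma arc_sub_geodesic : S' `<=` S.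
Proof.
have [f [f0 f1 fiso SE]] := geoS; have [k [kc kinj k0 k1 S'E]] := arcS'.
have xS : S x.
  by rewrite SE; exists 0 => //=; rewrite in_itv/= lexx mdist_ge0.
have yS : S y.
  by rewrite SE; exists (mdist x y) => //=; rewrite in_itv/= lexx mdist_ge0.
rewrite {1}S'E => _ [s0 s001 <-]; apply: contrapT => kS.
have /andP[s0_ge0 s0_le1] : 0 <= s0 <= 1 by move: s001; rewrite /= in_itv.
pose A := k @` `[0, s0[; pose B := k @` `]s0, 1].
have closed_im a b : 0 <= a -> b <= 1 -> closed (k @` `[a, b]).
  move=> a0 b1; apply: compact_closed; first exact: metric_hausdorff.
  apply: continuous_compact; last exact: segment_compact.
  apply: continuous_subspaceW kc => t /=; rewrite !in_itv/= => /andP[? ?].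
  by rewrite (le_trans a0)//= (le_trans _ b1).
have [cA cB] : closed (k @` `[0, s0]) /\ closed (k @` `[s0, 1]) by split; exact: closed_im.
have sepAB : separated A B.
  apply: (closed_separated cA cB) => [_ [t t0 <-]|_ [t t0 <-]||].
  - by exists t => //; move: t0; rewrite /= !in_itv/= => /andP[-> /ltW].
  - by exists t => //; move: t0; rewrite /= !in_itv/= => /andP[/ltW -> ->].
  - rewrite -subset0 => _ [[t + <-] [u + kut]]; rewrite /= !in_itv/= => t0 us.
    have : u = t by apply: kinj => //; rewrite in_itv/=; move: t0 us; lra.
    by move: t0 us; lra.
  - rewrite -subset0 => _ [[t + <-] [u + kut]]; rewrite /= !in_itv/= => t0 us.
    have : u = t by apply: kinj => //; rewrite in_itv/=; move: t0 us; lra.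
    by move: t0 us; lra.
have SAB : S `<=` A `|` B.
  move=> z zS; have : S' z by exact: geodesic_sub_arc.
  rewrite S'E => -[t /= t01 ktz]; move: (t01); rewrite in_itv/= => /andP[t0 t1].
  have [ts|st|ts] := ltgtP t s0.
  - by left; exists t => //=; rewrite in_itv/= t0.
  - by right; exists t => //=; rewrite in_itv/= st.
  - by exfalso; apply: kS; rewrite -ts ktz.
have cS : connected S.
  rewrite SE; apply: connected_continuous_connected; first exact: segment_connected.
  exact: isometry_within_continuous.
have [i0 i1] : 0 \in `[(0:R), 1] /\ 1 \in `[(0:R), 1].
  by rewrite !in_itv/= !lexx ler01.
have [sub|sub] := connected_subset sepAB SAB cS.
- have [t + kt] := sub y yS; rewrite /= in_itv/= => /andP[t0 ts].
  suff : t = 1 by lra.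
  by apply: kinj => //; rewrite ?in_itv/= ?kt ?k1//; lra.
- have [t + kt] := sub x xS; rewrite /= in_itv/= => /andP[st t1].
  suff : t = 0 by lra.
  by apply: kinj => //; rewrite ?in_itv/= ?kt ?k0//; lra.
Qed.

End Uniqueness.

Lemma geodesic_four_point_Rtree : geodesic_space -> four_point -> Rtree T.
Proof.
move=> geo T4 x y xy; have [S geoS] := geo x y; exists S; split=> //.
  exact: geodesic_is_arc.
move=> S' arcS'; apply/seteqP; split.
  exact: arc_sub_geodesic geoS arcS'.
exact: geodesic_sub_arc geoS arcS'.
Qed.

End FourPoint.

Section MetricQuotient.
Context {R : realType}.

Record pseudo_dist (Z : Type) := PseudoDist {
  pdist :> Z -> Z -> R ;
  pdistxx : forall x, pdist x x = 0 ;
  pdist_sym : forall x y, pdist x y = pdist y x ;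
  pdist_triangle : forall y x z, pdist x z <= pdist x y + pdist y z }.

(** Points are the classes themselves, so that positivity of the distance is
    set extensionality. *)
Definition metric_quotient Z (D : pseudo_dist Z) : Type :=
  set_type [set c | exists x, c = [set y | D x y = 0]].

Section Quotient.
Context Z (D : pseudo_dist Z).
Implicit Types (x y z : Z) (u v w : metric_quotient D).

HB.instance Definition _ := gen_eqMixin (metric_quotient D).
HB.instance Definition _ := gen_choiceMixin (metric_quotient D).

Lemma quotient_classP x : [set y | D x y = 0] \in
  [set c | exists x, c = [set y | D x y = 0]].
Proof. by rewrite inE; exists x. Qed.

Definition quotient_class x : metric_quotient D :=
  exist (fun c => c \in _) _ (quotient_classP x).

Lemma quotient_class_surj u : exists x, u = quotient_class x.
Proof.
case: u => c cP; have := cP; rewrite inE => -[x cE]; exists x.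
by apply: val_inj.
Qed.

Definition quotient_repr u : Z := projT1 (cid (quotient_class_surj u)).

Lemma quotient_reprK u : quotient_class (quotient_repr u) = u.
Proof. by rewrite /quotient_repr; case: cid. Qed.

Lemma quotient_classE x y : quotient_class x = quotient_class y -> D x y = 0.
Proof.
move=> /(congr1 val)/= /(congr1 (fun c : set Z => c y))/= E.
by rewrite E pdistxx.
Qed.

Lemma pdist_eq x y z : D x y = 0 -> D x z = D y z.
Proof.
move=> xy; have := pdist_triangle D x y z; have := pdist_triangle D y x z.
by rewrite (pdist_sym D y x) xy; lra.
Qed.

Definition quotient_dist u v := D (quotient_repr u) (quotient_repr v).

Lemma quotient_distE x y : quotient_dist (quotient_class x) (quotient_class y) = D x y.
Proof.
have := quotient_classE (quotient_reprK (quotient_class x)).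
have := quotient_classE (quotient_reprK (quotient_class y)).
by rewrite /quotient_dist => /pdist_eq yE /pdist_eq ->; rewrite !(pdist_sym D x) yE.
Qed.

Lemma quotient_distxx u : quotient_dist u u = 0.
Proof. exact: pdistxx. Qed.

Lemma quotient_dist_positivity u v : quotient_dist u v = 0 -> u = v.
Proof.
move=> uv; rewrite -(quotient_reprK u) -(quotient_reprK v).
by apply: val_inj => /=; apply/funext => z /=; rewrite (pdist_eq _ uv).
Qed.

Lemma quotient_dist_sym u v : quotient_dist u v = quotient_dist v u.
Proof. exact: pdist_sym. Qed.

Lemma quotient_dist_triangle v u w :
  quotient_dist u w <= quotient_dist u v + quotient_dist v w.
Proof. exact: pdist_triangle. Qed.

HB.instance Definition _ := @isMetric.Build R (metric_quotient D)
  quotient_dist quotient_distxx quotient_dist_positivity quotient_dist_sym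
  quotient_dist_triangle.

Lemma mdist_quotient x y : mdist (quotient_class x) (quotient_class y) = D x y.
Proof. exact: quotient_distE. Qed.

End Quotient.
End MetricQuotient.

Section KernelTree.
Context {R : realType}.

(** The Gromov products, at the root, of the ends of the branches of a rooted
    tree; [kernel x x] is the length of the branch [x]. *)
Record tree_kernel (Z : Type) := TreeKernel {
  kernel :> Z -> Z -> R ;
  kernelC : forall x y, kernel x y = kernel y x ;
  kernel_ge0 : forall x y, 0 <= kernel x y ;
  kernel_le : forall x y, kernel x y <= kernel x x ;
  kernel_ultra : forall x y z,
    Num.min (kernel x y) (kernel y z) <= kernel x z }.

Context (Z : Type) (k : tree_kernel Z).

Record tree_point := TreePoint {
  tip : Z ; height : R ; height_itv : 0 <= height <= k tip tip }.
Implicit Types (p q r s : tree_point).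

(** The height at which the paths from the root to [p] and to [q] separate. *)
Definition point_prod p q :=
  Num.min (Num.min (height p) (height q)) (k (tip p) (tip q)).

Lemma point_prodxx p : point_prod p p = height p.
Proof. by rewrite /point_prod minxx min_l//; case/andP: (height_itv p). Qed.

Lemma point_prodC p q : point_prod p q = point_prod q p.
Proof. by rewrite /point_prod minC kernelC [Num.min (height p) _]minC minC. Qed.

Lemma point_prod_le p q : point_prod p q <= height p.
Proof. by rewrite /point_prod !ge_min lexx. Qed.

Lemma point_prod_ultra p q r :
  Num.min (point_prod p q) (point_prod q r) <= point_prod p r.
Proof.
rewrite le_min; apply/andP; split.
  by rewrite /point_prod le_min !ge_min !lexx !orbT.
apply: le_trans (kernel_ultra k (tip p) (tip q) (tip r)).
by rewrite le_min /point_prod !ge_min !lexx !orbT.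
Qed.

Definition point_dist p q := height p + height q - 2 * point_prod p q.

Lemma point_distxx p : point_dist p p = 0.
Proof. by rewrite /point_dist point_prodxx; ring. Qed.

Lemma point_dist_sym p q : point_dist p q = point_dist q p.
Proof. by rewrite /point_dist point_prodC; ring. Qed.

Lemma point_dist_triangle q p r :
  point_dist p r <= point_dist p q + point_dist q r.
Proof.
rewrite /point_dist; have := point_prod_ultra p q r.
have := point_prod_le q p; have := point_prod_le q r; rewrite (point_prodC q p).
move: (point_prod p q) (point_prod q r) (point_prod p r) => a b c.
by rewrite ge_min => ? ? /orP[]; lra.
Qed.

Definition tree_dist := PseudoDist point_distxx point_dist_sym point_dist_triangle.
Definition kernel_tree : metricType R := metric_quotient tree_dist.

(** Base change for zero-hyperbolicity: the four ultrametric inequalities at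
    the root that involve a diagonal suffice. *)
Lemma kernel_tree_four_point : four_point kernel_tree.
Proof.
move=> x y z w.
have [p ->] := quotient_class_surj x; have [q ->] := quotient_class_surj y.
have [r ->] := quotient_class_surj z; have [s ->] := quotient_class_surj w.
rewrite !mdist_quotient /= /point_dist.
have := point_prod_ultra p q r; have := point_prod_ultra p s r.
have := point_prod_ultra q p s; have := point_prod_ultra q r s.
rewrite (point_prodC s r) (point_prodC q p).
move: (point_prod p q) (point_prod p r) (point_prod p s).
move: (point_prod q r) (point_prod q s) (point_prod r s) => a b c d e f.
rewrite !ge_min => h1 h2 h3 h4; rewrite leNgt; apply/negP; rewrite gt_max.
move=> /andP[h5 h6]; case/orP: h1 => h1; case/orP: h2 => h2.
all: by case/orP: h3 => h3; case/orP: h4 => h4; move: h1 h2 h3 h4 h5 h6; lra.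
Qed.

(** Heights out of range are clamped, to avoid carrying proofs along. *)
Definition point_at (x : Z) (u : R) : tree_point.
Proof.
exists x (Num.max 0 (Num.min u (k x x))).
by rewrite le_max lexx/= ge_max kernel_ge0 ge_min lexx orbT.
Defined.

Lemma height_point_at x u : 0 <= u <= k x x -> height (point_at x u) = u.
Proof. by move=> /andP[u0 uk]; rewrite /= min_l// max_r. Qed.

Lemma point_dist_same_tip p q : tip p = tip q ->
  point_dist p q = `|height p - height q|.
Proof.
move=> E; have := height_itv p; have := height_itv q.
rewrite /point_dist /point_prod -E => /andP[_ hq] /andP[_ hp].
have [le_pq|lt_qp] := leP (height p) (height q).
- by rewrite min_l// distrC ger0_norm ?subr_ge0//; ring.
- by rewrite min_l// gtr0_norm ?subr_gt0//; ring.
Qed.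

Lemma point_dist_across p q r s : tip r = tip p -> tip s = tip q ->
  point_prod p q <= height r <= height p ->
  point_prod p q <= height s <= height q ->
  point_dist r s = height r + height s - 2 * point_prod p q.
Proof.
move=> rp sq; rewrite /point_dist /point_prod rp sq => hr hs.
congr (_ - 2 * _); move: hr hs.
move: (height p) (height q) (height r) (height s) (k _ _) => a b c d e.
move=> /andP[mc ca] /andP[md db]; set m := Num.min _ e in mc md *.
have me : m <= e by rewrite ge_min lexx orbT.
have mE : [|| m == a, m == b | m == e].
  by rewrite /m !minElt; do ![case: ifP => _]; rewrite eqxx ?orbT.
clearbody m; apply/eqP; rewrite eq_le !le_min mc md me !andbT !ge_min.
by case/or3P: mE => /eqP ->; rewrite ?ca ?db ?lexx ?orbT.
Qed.

(** Go down the branch of [p] to height [m], then up the branch of [q]. *)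
Lemma kernel_tree_geodesic : geodesic_space kernel_tree.
Proof.
move=> x y; have [p ->] := quotient_class_surj x; have [q ->] := quotient_class_surj y.
have [hp0 hp] := andP (height_itv p); have [hq0 hq] := andP (height_itv q).
set m := point_prod p q.
have mp : m <= height p by exact: point_prod_le.
have mq : m <= height q by rewrite /m point_prodC point_prod_le.
have m0 : 0 <= m by rewrite /m /point_prod !le_min hp0 hq0 kernel_ge0.
pose g (t : R) := if t <= height p - m then point_at (tip p) (height p - t)
            else point_at (tip q) (t - height p + m *+ 2).
have dE : mdist (quotient_class tree_dist p) (quotient_class tree_dist q)
    = (height p - m) + (height q - m).
  by rewrite mdist_quotient /= /point_dist -/m; ring.
have below (t : R) : 0 <= t <= height p - m ->
    height (point_at (tip p) (height p - t)) = height p - t.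
  by move=> ?; rewrite height_point_at//; move: hp m0; lra.
have above (t : R) : height p - m <= t <= (height p - m) + (height q - m) ->
    height (point_at (tip q) (t - height p + m *+ 2)) = t - height p + m *+ 2.
  by move=> ?; rewrite height_point_at//; move: hq m0; lra.
exists [set quotient_class tree_dist (g t) | t in
  `[0, mdist (quotient_class tree_dist p) (quotient_class tree_dist q)]].
exists (quotient_class tree_dist \o g); split => //.
- apply: mdist_positivity; rewrite mdist_quotient /g subr_ge0 mp.
  rewrite /= point_dist_same_tip// below ?lexx ?subr_ge0//.
  by rewrite subr0 subrr normr0.
- rewrite dE; apply: mdist_positivity; rewrite mdist_quotient /g; case: ifP => le_m.
    rewrite -[LHS]/(point_dist _ _) (@point_dist_across p q)// 
      ?below -/m ?mp ?mq ?lexx//; move: le_m mq; lra.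
  rewrite /= point_dist_same_tip// above; last by move: mp mq; lra.
  by apply/normr0P/eqP; ring.
- rewrite dE => s t; wlog st : s t / s <= t => [wl|] sI tI.
    have [/wl|/ltW/wl] := leP s t; first exact.
    by rewrite metric_sym distrC; exact.
  move: sI tI; rewrite !in_itv/= mdist_quotient => /andP[s0 sd] /andP[t0 td].
  rewrite (distrC s) ger0_norm ?subr_ge0// /g.
  have [tp|pt] := leP t (height p - m).
    rewrite (le_trans st tp) /= point_dist_same_tip// !below ?s0 ?t0 ?(le_trans st)//.
    by rewrite ger0_norm; lra.
  have [sp|ps] := leP s (height p - m).
    by rewrite /= (@point_dist_across p q)// ?below ?above ?s0 -/m; lra.
  rewrite /= point_dist_same_tip// !above; try lra.
  by rewrite distrC ger0_norm; lra.
Qed.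

Lemma kernel_tree_Rtree : Rtree kernel_tree.
Proof.
exact: geodesic_four_point_Rtree kernel_tree_geodesic kernel_tree_four_point.
Qed.

Definition tree_embed (x : Z) : kernel_tree :=
  quotient_class tree_dist (point_at x (k x x)).

Lemma mdist_tree_embed x y :
  mdist (tree_embed x) (tree_embed y) = k x x + k y y - 2 * k x y.
Proof.
rewrite mdist_quotient /= /point_dist /point_prod !height_point_at ?kernel_ge0 ?lexx//.
by rewrite min_r// le_min kernel_le kernelC kernel_le.
Qed.

End KernelTree.

Section WalkTree.
Context {R : realType} {A : metricType R} (a0 : A).

Definition walk_kernel := TreeKernel (walk_prodC a0) (walk_prod_ge0 a0)
  (walk_prod_le a0) (walk_prod_ultra a0).

Lemma mdist_walk_tree p q : mdist (tree_embed walk_kernel p)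
  (tree_embed walk_kernel q) = walk_dist a0 p q.
Proof. by rewrite mdist_tree_embed /= !walk_prodxx. Qed.

End WalkTree.

(** * Shadows on the boundary of a hyperbolic space *)

Section Shadows.
Context {R : realType} (X : metricType R).
Implicit Types (o p q x y z : X) (u v w : nat -> X).

Lemma gromov_prodC p x y : gromov_prod p x y = gromov_prod p y x.
Proof.
rewrite /gromov_prod [mdist x p + _]addrC (metric_sym x y).
by rewrite (metric_sym x p) (metric_sym y p).
Qed.

Lemma gromov_prod_le p x y : gromov_prod p x y <= mdist x p.
Proof.
rewrite /gromov_prod; have := metric_triangle p x y.
by rewrite (metric_sym p x) (metric_sym p y); lra.
Qed.

Lemma gromov_prod_base p q x y :
  gromov_prod p x y <= gromov_prod q x y + mdist p q.
Proof.
rewrite /gromov_prod; have := metric_triangle x q p; have := metric_triangle y q p.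
by rewrite (metric_sym q p) (metric_sym y p) (metric_sym y q); lra.
Qed.

Lemma gromov_prod4 (delta : R) p : (forall x y z,
    Num.min (gromov_prod p x y) (gromov_prod p y z) - delta <= gromov_prod p x z) ->
  0 <= delta -> forall (c : R) x a b y,
  c <= gromov_prod p x a -> c <= gromov_prod p a b -> c <= gromov_prod p b y ->
  c - 2 * delta <= gromov_prod p x y.
Proof.
move=> hyp d0 c x a b y h1 h2 h3; have := hyp x a y; have := hyp a b y.
rewrite lerBlDr ge_min => /orP h4; rewrite lerBlDr ge_min => /orP h5.
by case: h4 => h4; case: h5 => h5; lra.
Qed.

Lemma limn_einf_ge (f : nat -> \bar R) a N :
  (forall n, (N <= n)%N -> (a <= f n)%E) -> (a <= limn_einf f)%E.
Proof.
move=> af; rewrite limn_einf_lim (cvg_lim _ (@cvg_einfs_sup _ f))//.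
apply: (@le_trans _ _ (einfs f N)); last by apply: ereal_sup_ubound; exists N.
by apply: le_ereal_inf_tmp => _ [k /= Nk <-]; exact: af.
Qed.

Lemma limn_einf_gt (f : nat -> \bar R) a : (a < limn_einf f)%E ->
  exists N, forall n, (N <= n)%N -> (a <= f n)%E.
Proof.
rewrite limn_einf_lim (cvg_lim _ (@cvg_einfs_sup _ f))// => /ereal_sup_gt[_ [N _ <-] aN].
exists N => n Nn; apply: (le_trans (ltW aN)).
by apply: ereal_inf_lbound; exists n.
Qed.

Lemma equiv_inftyP u v : equiv_infty u v -> forall p (M : R),
  exists N, forall n, (N <= n)%N -> M <= gromov_prod p (u n) (v n).
Proof.
move=> [q /cvgryPge uv] p M; have [N _ HN] := uv (M + mdist q p).
by exists N => n /HN /= H; have := gromov_prod_base q p (u n) (v n); lra.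
Qed.

(** The sequence is the part of a rough ray through [x] at integer times; its
    Gromov products with [x] are computed from the roughness constant alone,
    so the error [c] is the same for all points. *)
Lemma visual_shadow o : visual X -> exists c, forall x, exists u,
  [/\ cvg_infty u, equiv_infty u u &
    exists N, forall n, (N <= n)%N -> mdist x o - c <= gromov_prod o x (u n)].
Proof.
move=> [p [K XE]].
exists (5 / 2 * K + 2 * mdist o p) => x.
have : [set: X] x by [].
rewrite XE => -[_ [f [f0 fK ->]]] [t /= t0 fx]; rewrite in_itv/= andbT in t0.
have nat0 n : 0 <= n%:R :> R by [].
have K0 : 0 <= K.
  by have [_] := fK 0 0 (lexx _) (lexx _); rewrite mdistxx subrr normr0 add0r.
have fp n : n%:R - K <= mdist (f n%:R) p.
  by have [+ _] := fK n%:R 0 (nat0 n) (lexx _); rewrite subr0 ger0_norm// f0.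
have large n m : Num.min n%:R m%:R - 3 / 2 * K <= gromov_prod p (f n%:R) (f m%:R).
  have [_] := fK n%:R m%:R (nat0 n) (nat0 m).
  rewrite /gromov_prod (metric_sym p); have := fp n; have := fp m.
  by case: (leP (n%:R : R) m%:R) => nm; [rewrite ler0_norm|rewrite gtr0_norm]; lra.
have floor_lt (M : R) : exists N : nat, forall n, (N <= n)%N -> M <= n%:R.
  exists (Num.trunc M).+1 => n; rewrite -(ler_nat R); apply: le_trans.
  exact/ltW/truncnS_gt.
exists (fun n => f n%:R); split.
- exists p; apply/cvgryPge => M; have [N HN] := floor_lt (M + 3 / 2 * K).
  exists ([set n | (N <= n)%N], [set n | (N <= n)%N]).
    by split; exists N.
  move=> [i j] /= [/HN Mi /HN Mj]; apply: le_trans (large i j).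
  by rewrite lerBrDr le_min Mi Mj.
- exists p; apply/cvgryPge => M; have [N HN] := floor_lt (M + 3 / 2 * K).
  exists N => // i /= /HN Mi; apply: le_trans (large i i).
  by rewrite minxx lerBrDr.
- have [N HN] := floor_lt t; exists N => n /HN tn.
  have := gromov_prod_base p o x (f n%:R); have := metric_triangle x p o.
  rewrite (metric_sym p o) => h1 h2.
  suff : mdist x p - 5 / 2 * K <= gromov_prod p x (f n%:R) by lra.
  have [h3] := fK t n%:R t0 (nat0 n); rewrite fx distrC ger0_norm ?subr_ge0//.
  have [h4] := fK t 0 t0 (lexx _); rewrite fx f0 subr0 ger0_norm//.
  by have := fp n; rewrite /gromov_prod (metric_sym p); lra.
Qed.

Definition boundary_pt u (cu : cvg_infty u) : boundary X.
Proof.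
exists [set y | cvg_infty y /\ equiv_infty u y].
by rewrite inE; exists u.
Defined.

Lemma boundary_prod_ge p u v cu cv (c : R) N : equiv_infty u u -> equiv_infty v v ->
  (forall n, (N <= n)%N -> c <= gromov_prod p (u n) (v n)) ->
  (c%:E <= boundary_prod p (@boundary_pt u cu) (@boundary_pt v cv))%E.
Proof.
move=> uu vv cuv; apply: (@le_trans _ _ (limn_einf
  (fun i => (gromov_prod p (u i) (v i))%:E))).
  by apply: (@limn_einf_ge _ _ N) => n /cuv; rewrite lee_fin.
by apply: ereal_sup_ubound; exists u => //; exists v.
Qed.

End Shadows.

(** The end of the ray through [x] determines [x] up to its height.  The two
    conclusions are the two comparisons between the Gromov product of two
    points and that of their ends, each obtained by applying hyperbolicity
    twice along a chain such as [x], [u x n], [u y n], [y], and expressed with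
    the visual metric. *)
Lemma boundary_shadow {R : realType} {X : metricType R} (o : X)
    (d : visual_metric X) : hyperbolic X -> visual X ->
  exists (xi : X -> boundary X) (eps C : R), [/\ 0 < eps, 0 < C,
    forall x y, d (xi x) (xi y) <= C * expR (- (eps * gromov_prod o x y)) &
    forall lam, 0 < lam -> exists C', forall x y t,
      t <= mdist x o -> t <= mdist y o ->
      d (xi x) (xi y) <= lam * expR (- (eps * t)) -> t - C' <= gromov_prod o x y].
Proof.
move=> [delta d0 hyp] /(visual_shadow o)[c shadow].
have [u /= uP] := choice shadow.
have cu x : cvg_infty (u x) by have [] := uP x.
have uu x : equiv_infty (u x) (u x) by have [] := uP x.
have [p [eps [C [eps0 C0 dP]]]] := vdist_visual d.
pose xi x := boundary_pt (cu x); exists xi, eps.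
exists (C * expR (eps * (`|c| + 2 * delta + mdist o p))); split=> //.
- by rewrite mulr_gt0// expR_gt0.
- move=> x y; have [_] := dP (xi x) (xi y).
  have [_ _ [N1 HN1]] := uP x; have [_ _ [N2 HN2]] := uP y.
  have : ((gromov_prod o x y - `|c| - 2 * delta - mdist o p)%:E <=
          boundary_prod p (xi x) (xi y))%E.
    apply: (@boundary_prod_ge _ _ _ _ _ _ _ _ (maxn N1 N2)) => // n.
    rewrite geq_max => /andP[/HN1 h1 /HN2 h2].
    have := gromov_prod_base o p (u x n) (u y n).
    suff : gromov_prod o x y - `|c| - 2 * delta <= gromov_prod o (u x n) (u y n) by lra.
    have := ler_norm c; have := gromov_prod_le o x y; have := gromov_prod_le o y x.
    rewrite (gromov_prodC o y x) => h3 h4 h5.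
    apply: (@gromov_prod4 _ _ delta o _ d0 _ _ x y) => //; last by lra.
      by rewrite (gromov_prodC o (u x n)); lra.
    by have := normr_ge0 c; lra.
  case: boundary_prod => [r| |] //=; rewrite ?lee_fin.
  + move=> h1 /le_trans; apply.
    rewrite -mulrA ler_pM2l// -expRD ler_expR.
    by have := ler_wpM2l (ltW eps0) h1; lra.
  + rewrite gt0_muley ?lte_fin//= mule0 lee_fin => _ /le_trans; apply.
    by rewrite !mulr_ge0 ?expR_ge0// ltW.
- move=> lam lam0; exists (`|c| + `|ln (C * lam) / eps| + 1 + mdist p o + 4 * delta).
  move=> x y t tx ty dle; have [+ _] := dP (xi x) (xi y).
  have [_ _ [N1 HN1]] := uP x; have [_ _ [N2 HN2]] := uP y.
  set b := boundary_prod _ _ _ => bd.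
  have : ((t - `|ln (C * lam) / eps| - 1)%:E < b)%E.
    move: bd; case: b => [r| |]; last 2 first.
    + by rewrite ltry.
    + rewrite gt0_muleNy ?lte_fin//= gt0_muley ?lte_fin ?invr_gt0//.
    rewrite -EFinM /= lee_fin lte_fin => h1.
    have : expR (- (eps * r)) <= C * lam * expR (- (eps * t)).
      by rewrite -mulrA -ler_pdivrMl// (le_trans h1).
    have Cl0 : 0 < C * lam by rewrite mulr_gt0.
    rewrite -{1}(lnK Cl0) -expRD ler_expR => h2.
    have := ler_norm (ln (C * lam) / eps); rewrite ler_pdivrMr// => h3.
    rewrite -(ltr_pM2l eps0); nra.
  move=> /ereal_sup_gt[_ [u' [cu' uu']] [v' [cv' vv']] <- /limn_einf_gt[N HN]].
  have [M1 HM1] := equiv_inftyP uu' o t; have [M2 HM2] := equiv_inftyP vv' o t.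
  pose n := maxn (maxn N (maxn N1 N2)) (maxn M1 M2).
  have /HN : (N <= n)%N by rewrite /n; lia.
  have /HN1 : (N1 <= n)%N by rewrite /n; lia.
  have /HN2 : (N2 <= n)%N by rewrite /n; lia.
  have /HM1 : (M1 <= n)%N by rewrite /n; lia.
  have /HM2 : (M2 <= n)%N by rewrite /n; lia.
  rewrite lee_fin => h1 h2 h3 h4 h5.
  have := gromov_prod_base p o (u' n) (v' n) => h6.
  have := ler_norm c; have := normr_ge0 (ln (C * lam) / eps).
  have := normr_ge0 c; have := mdist_ge0 p o => h7 h8 h9 h10.
  have h : t - `|c| - `|ln (C * lam) / eps| - 1 - mdist p o - 2 * delta
    <= gromov_prod o (u x n) (u y n).
    apply: (@gromov_prod4 _ _ delta o _ d0 _ _ (u' n) (v' n)) => //; try lra.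
    by rewrite gromov_prodC; lra.
  rewrite [leLHS](_ : _ = t - `|c| - `|ln (C * lam) / eps| - 1 - mdist p o
     - 2 * delta - 2 * delta); last by ring.
  apply: (@gromov_prod4 _ _ delta o _ d0 _ x (u x n) (u y n)) => //; try lra.
  by rewrite gromov_prodC; lra.
Qed.

(** * Finitely valued random variables and random ultrametrics *)

Section FiniteRandomVariables.
Context {R : realType} {disp : measure_display} {Omega : measurableType disp}
        (P : probability Omega R).

(** Every preimage of such a map is an event, whatever the target: no
    sigma-algebra on [T] is involved. *)
Definition finite_rv (T : Type) (Y : Omega -> T) : Prop :=
  finite_set (range Y) /\ forall t, measurable (Y @^-1` [set t]).

Lemma finite_rv_preimage T (Y : Omega -> T) (B : set T) :
  finite_rv Y -> measurable (Y @^-1` B).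
Proof.
move=> [finY mY]; rewrite [X in measurable X](_ : _ =
    \bigcup_(t in range Y `&` B) (Y @^-1` [set t])).
  by apply: fin_bigcup_measurable => //; exact: finite_setIl.
apply/seteqP; split=> [w Bw|w [t [_ Bt] /= ->]//].
by exists (Y w).
Qed.

(** Any function of such a variable is again one; together with pairs, this
    reaches every function of finitely many of them. *)
Lemma finite_rv_factor S T (Y : Omega -> S) (Z : Omega -> T) : finite_rv Y ->
  (forall w w', Y w = Y w' -> Z w = Z w') -> finite_rv Z.
Proof.
move=> fY YZ; split; last first.
  move=> t; rewrite [X in measurable X](_ : _ = Y @^-1` (Y @` (Z @^-1` [set t]))).
    exact: finite_rv_preimage.
  by apply/seteqP; split=> [w Zw|w [w' <- /YZ ->]//]; exists w.
have [->//|/set0P[_ [w0 _ _]]] := eqVneq (range Z) set0.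
have /choice[g gP] : forall s, exists t, forall w, Y w = s -> Z w = t.
  move=> s; have [[w ws]|no] := pselect (exists w, Y w = s).
    by exists (Z w) => w' w's; apply: YZ; rewrite ws w's.
  by exists (Z w0) => w ws; exfalso; apply: no; exists w.
have := finite_image g fY.1; apply: sub_finite_set => _ [w _ <-].
by exists (Y w); [exists w|rewrite (gP (Y w) w)].
Qed.

Lemma finite_rv_pair S T (Y : Omega -> S) (Z : Omega -> T) :
  finite_rv Y -> finite_rv Z -> finite_rv (fun w => (Y w, Z w)).
Proof.
move=> [finY mY] [finZ mZ]; split.
  apply: (@sub_finite_set _ _ (range Y `*` range Z)); last exact: finite_setX.
  by move=> _ [w _ <-]; split; exists w.
move=> [s t]; rewrite [X in measurable X](_ : _ = Y @^-1` [set s] `&` Z @^-1` [set t]).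
  exact: measurableI.
by apply/seteqP; split=> [w [<- <-]//|w /= [-> ->]].
Qed.

Lemma finite_rv_cst T (t : T) : finite_rv (fun _ : Omega => t).
Proof.
split; first by apply: (@sub_finite_set _ _ [set t]) => // _ [w _ <-].
move=> t'; have [->|tt'] := pselect (t = t').
  by rewrite (_ : _ @^-1` _ = setT)//; apply/seteqP; split.
by rewrite (_ : _ @^-1` _ = set0)//; apply/seteqP; split.
Qed.

Lemma finite_rv_seq (I : Type) T (Y : I -> Omega -> T) (s : seq I) :
  (forall i, finite_rv (Y i)) -> finite_rv (fun w => [seq Y i w | i <- s]).
Proof.
move=> fY; elim: s => [|i s IH] /=; first exact: finite_rv_cst.
by apply: finite_rv_factor (finite_rv_pair (fY i) IH) _ => w w' [-> ->].
Qed.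

Lemma finite_rv_comp S T (g : S -> T) (Y : Omega -> S) :
  finite_rv Y -> finite_rv (g \o Y).
Proof. by move=> /finite_rv_factor; apply => w w' /= ->. Qed.

Lemma finite_rv_measurable (Y : Omega -> R) : finite_rv Y -> measurable_fun setT Y.
Proof. by move=> fY _ B _; rewrite setTI; exact: finite_rv_preimage. Qed.

Lemma finite_rv_integrable (Y : Omega -> R) : finite_rv Y ->
  P.-integrable setT (EFin \o Y).
Proof.
move=> fY; apply: measurable_bounded_integrable => //.
- by rewrite (le_lt_trans (probability_le1 P measurableT))// ltry.
- exact: finite_rv_measurable.
- case: fY => finY _; have [M HM] : exists M, forall w, `|Y w| <= M.
    have /finite_seqP[s sE] := finite_image (fun x : R => `|x|) finY.
    exists (\sum_(x <- s) `|x|) => w.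
    have : `|Y w| \in s.
      by have : [set` s] `|Y w| by rewrite -sE; exists (Y w) => //; exists w.
    move=> ws; rewrite (big_rem _ ws)/= normr_id lerDl sumr_ge0//.
  by exists M; split; [exact: num_real|move=> x Mx w _ /=; exact: le_trans (HM w) (ltW Mx)].
Qed.

Lemma expectation_cst (r : R) : \int[P]_w r = r.
Proof.
rewrite Rintegral_cst// [X in fine X](_ : _ = 1%E) ?mulr1//.
exact: probability_setT.
Qed.

Lemma expectation_affine (Y : Omega -> R) (c r : R) : finite_rv Y ->
  \int[P]_w (c * Y w + r) = c * \int[P]_w Y w + r.
Proof.
move=> fY; have intY := finite_rv_integrable fY.
have intcY := finite_rv_integrable (finite_rv_comp (fun t : R => c * t) fY).
rewrite RintegralD//; last exact/finite_rv_integrable/finite_rv_cst.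
by rewrite RintegralZl// expectation_cst.
Qed.

(** The integral of a nonnegative function is a supremum over simple
    minorants, hence monotone without any measurability.  The distance between
    two random points of a nonseparable space need not be measurable, and its
    logarithm is only ever bounded from below through these two lemmas. *)
Lemma le_integral_any (f g : Omega -> \bar R) :
  (forall w, (f w <= g w)%E) -> (\int[P]_w f w <= \int[P]_w g w)%E.
Proof.
move=> fg; rewrite integralE [leRHS]integralE.
have mono (f1 f2 : Omega -> \bar R) : (forall w, 0 <= f1 w)%E ->
    (forall w, f1 w <= f2 w)%E -> (\int[P]_w f1 w <= \int[P]_w f2 w)%E.
  move=> f10 f12; rewrite !ge0_integralTE//; last by move=> w; exact: le_trans (f12 w).
  by apply: le_ereal_sup => _ [h hf <-]; exists h => // w; exact: le_trans (f12 w).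
apply: leeB; apply: mono => w.
- exact: funepos_ge0.
- by rewrite !funeposE ge_max !le_max fg lexx orbT.
- exact: funeneg_ge0.
- by rewrite !funenegE ge_max !le_max leeN2 fg lexx orbT.
Qed.

Lemma ae_le_integral_any (Y : Omega -> R) (g : Omega -> \bar R) : finite_rv Y ->
  {ae P, forall w, ((Y w)%:E <= g w)%E} ->
  (\int[P]_w (Y w)%:E <= \int[P]_w g w)%E.
Proof.
move=> fY [N [mN PN0 YgN]].
pose Y' w : \bar R := if w \in N then -oo%E else (Y w)%:E.
pose Y1 w : \bar R := (Y w)%:E.
have mY : measurable_fun setT Y1 by exact/measurable_EFinP/finite_rv_measurable.
have mY' : measurable_fun setT Y'.
  apply: measurable_fun_ifT => //.
  apply: (measurable_fun_bool true).
  rewrite setTI (_ : _ @^-1` _ = N)//.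
  by apply/seteqP; split=> w /=; [exact: set_mem|exact: mem_set].
rewrite (@ae_eq_integral _ _ _ _ _ Y')//; last first.
  exists N; split => // w /= H; apply: contrapT => wN; apply: H => _.
  by rewrite /Y' memNset.
apply: le_integral_any => w; rewrite /Y'; case: ifPn => [_|]; first by rewrite leNye.
by rewrite notin_setE => wN; apply: contrapT => H; apply: wN; exact: YgN.
Qed.

End FiniteRandomVariables.

Section CountableUnions.

Lemma countable_bigcup_measurable {disp : measure_display}
    {Omega : measurableType disp} (I : Type) (D : set I) (F : I -> set Omega) :
  countable D -> (forall i, D i -> measurable (F i)) ->
  measurable (\bigcup_(i in D) F i).
Proof.
move=> /countable_injP[k kinj] mF.
rewrite [X in measurable X](_ : _ =
    \bigcup_n \bigcup_(i in [set i | D i /\ k i = n]) F i); last first.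
  apply/seteqP; split=> [w [i Di Fw]|w [n _ [i [Di _] Fw]]]; last by exists i.
  by exists (k i) => //; exists i.
apply: bigcupT_measurable => n.
apply: fin_bigcup_measurable => [|i [Di _]]; last exact: mF.
have [[i [Di ki]]|no] := pselect (exists i, D i /\ k i = n).
  apply: (@sub_finite_set _ _ [set i]) => // j [Dj kj].
  by apply: kinj; rewrite ?inE// ki kj.
rewrite (_ : [set i | _] = set0)//; rewrite -subset0 => i Hi.
by apply: no; exists i.
Qed.

End CountableUnions.

Section RandomUltrametric.
Context {R : realType}.

Lemma metric_ball_open (Y : metricType R) (y : Y) (r : R) :
  open [set z | mdist y z < r].
Proof.
rewrite openE => z /= yz; rewrite /interior.
apply/metricType_numDomainType.nbhs_mdistP; exists (r - mdist y z) => /=.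
  by rewrite subr_gt0.
by move=> t /= zt; rewrite (le_lt_trans (metric_triangle _ z _))// -ltrBrDl.
Qed.

(** What a log-stochastic embedding into an ultrametric space becomes when
    only countably many points [z a] are looked at.  The integral of the
    logarithm is that of an almost everywhere equal function [l], because [u]
    is modified on a null set to make its sublevel sets measurable. *)
Record random_ultrametric (A : Type) (Y : metricType R) (z : A -> Y) (B s D : R)
    (disp : measure_display) (Omega : measurableType disp)
    (P : probability Omega R) (u : Omega -> A -> A -> R) : Prop := {
  ru_ge0 : forall w a b, 0 <= u w a b;
  ru_xx : forall w a b, z a = z b -> u w a b = 0;
  ru_sym : forall w a b, u w a b = u w b a;
  ru_ultra : forall w a b c, u w a c <= Num.max (u w a b) (u w b c);
  ru_lt : forall w a b, u w a b < B;
  ru_measurable : forall a b r, measurable [set w | u w a b < r];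
  ru_lower : {ae P, forall w, forall a b, s * mdist (z a) (z b) <= u w a b};
  ru_log : forall a b, exists l : Omega -> \bar R,
    {ae P, forall w, l w = lne (u w a b)%:E} /\
    (\int[P]_w l w <= lne (s * D * mdist (z a) (z b))%:E)%E }.

(** The events come from separability and the ultrametric inequality: two
    points are at distance less than [r] exactly when they lie in a common
    ball of radius [r] centred in a countable dense set.  This is true off a
    null set [N] only, where [u] is set to be zero; doing so can only lower
    logarithms. *)
Lemma log_embedding_random_ultrametric (A : Type) (Y : metricType R) (z : A -> Y)
    (y0 : Y) (U : metricType R) (u0 : U) :
  countable [set: A] -> bounded_space U -> ultrametric U ->
  log_stochastic_biLipschitz_embeds y0 u0 ->
  exists (B s D : R) (disp : measure_display) (Omega : measurableType disp)
    (P : probability Omega R) (u : Omega -> A -> A -> R),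
    [/\ 0 < B, 0 < s, 0 < D & random_ultrametric z B s D P u].
Proof.
move=> cA [B0 B0P] ultraU.
case=> disp; case=> Omega; case=> P; case=> phi.
case=> -[mphi sepphi _] [D] [s] [D0 s0 phiP].
have [S SP] := choice (fun a => sepphi (z a)).
have [Dn DnP] := choice (fun a => (SP a).1).
have aeall (Q : A -> Omega -> Prop) : (forall a, {ae P, forall w, Q a w}) ->
    {ae P, forall w, forall a, Q a w}.
  move=> HQ; have [k kinj] := countable_injP _ cA.
  have : {ae P, forall w, forall n, forall a, k a = n -> Q a w}.
    apply: ae_foralln => n; have [[a ka]|no] := pselect (exists a, k a = n).
      apply: filterS (HQ a) => w Qw b kb.
      by rewrite (kinj b a)// ?inE// ka kb.
    by apply: aeW => w a ka; exfalso; apply: no; exists a.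
  by apply: filterS => w H a; exact: (H (k a) a erefl).
have [N [mN PN0 goodN]] : {ae P, forall w, (forall a, S a (phi w (z a))) /\
    forall a b, s * mdist (z a) (z b) <= mdist (phi w (z a)) (phi w (z b))}.
  have G1 := aeall _ (fun a => (SP a).2).
  have G2 := aeall _ (fun a => aeall _ (fun b => (phiP (z a) (z b)).1)).
  by apply: filterS2 G1 G2 => w; split.
have good w : ~ N w -> (forall a, S a (phi w (z a))) /\
    forall a b, s * mdist (z a) (z b) <= mdist (phi w (z a)) (phi w (z b)).
  by move=> Nw; apply: contrapT => H; apply: Nw; exact: goodN.
pose u w a b : R := if w \in N then 0 else mdist (phi w (z a)) (phi w (z b)).
have B1 : 0 < `|B0| + 1 by rewrite ltr_wpDl.
exists (`|B0| + 1), s, D, disp, Omega, P, u; split=> //.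
split.
- by move=> w a b; rewrite /u; case: ifP => _ //; exact: mdist_ge0.
- by move=> w a b E; rewrite /u E; case: ifP => _ //; exact: mdistxx.
- by move=> w a b; rewrite /u metric_sym.
- by move=> w a b c; rewrite /u; case: ifP => _; [rewrite maxxx|exact: ultraU].
- move=> w a b; rewrite /u; case: ifP => _; first exact: B1.
  rewrite (le_lt_trans (B0P _ _ I I))// (le_lt_trans (ler_norm _))// ltrDl//.
- move=> a b r; have [r0|r0] := leP r 0.
    rewrite (_ : [set w | _] = set0)//; rewrite -subset0 => w /=.
    apply/negP; rewrite -leNgt (le_trans r0)// /u.
    by case: ifP => _ //; exact: mdist_ge0.
  pose E d c := [set w | mdist d (phi w (z c)) < r].
  have mE d c : measurable (E d c).
    apply: (mphi (z c) [set y | mdist d y < r]); apply: sub_sigma_algebra.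
    exact: metric_ball_open.
  rewrite (_ : [set w | _] = N `|` (~` N `&` \bigcup_(d in Dn a) (E d a `&` E d b))).
    apply: measurableU => //; apply: measurableI; first exact: measurableC.
    apply: countable_bigcup_measurable; first by have [] := DnP a.
    by move=> d _; exact: measurableI.
  apply/seteqP; split=> w /=.
    rewrite /u; case: ifPn; rewrite ?in_setE ?notin_setE; first by left.
    move=> Nw uab; right; split => //.
    have [_ _ clS] := DnP a; have [/(_ a)/clS + _] := good w Nw.
    move=> /(_ _ (open_nbhs_nbhs (conj (metric_ball_open (phi w (z a)) r) _))).
    rewrite /= mdistxx => /(_ r0)[d [dD /= ad]]; exists d => //; split; rewrite /E /=.
      by rewrite metric_sym.
    by rewrite (le_lt_trans (ultraU _ (phi w (z a)) _))// gt_max metric_sym ad.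
  rewrite /u => -[Nw|[Nw [d _ [da db]]]]; first by rewrite mem_set.
  rewrite memNset// (le_lt_trans (ultraU _ d _))// gt_max db andbT.
  by rewrite metric_sym.
- exists N; split => // w /= H; apply: contrapT => Nw; apply: H => a b.
  by rewrite /u memNset//; have [_] := good w Nw.
- move=> a b; exists (fun w => lne (mdist (phi w (z a)) (phi w (z b)))%:E).
  split; last exact: (phiP (z a) (z b)).2.
  exists N; split => // w /= H; apply: contrapT => Nw; apply: H.
  by rewrite /u memNset.
Qed.

End RandomUltrametric.

(** * The tree of balls of a random ultrametric *)

Section BallTree.
Context {R : realType} {A : metricType R} (h : A -> nat) (eps B : R).
Implicit Types (a b c : A) (u : A -> A -> R).

(** The last level at which [a] and [b] lie in a common ball of radius
    [B * expR (- eps * n)], in the tree where the branch of a point stops at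
    its height. *)
Definition parting_level u a b : nat :=
  \max_(n < (minn (h a) (h b)).+1 | u a b < B * expR (- (eps * n%:R))) n.

Section Fixed.
Context (eps_gt0 : 0 < eps) (B_gt0 : 0 < B) (u : A -> A -> R).
Context (uB : forall a b, u a b < B).

Lemma radius_decr m n : (m <= n)%N ->
  B * expR (- (eps * n%:R)) <= B * expR (- (eps * m%:R)).
Proof.
move=> mn; rewrite ler_pM2l// ler_expR lerN2 ler_pM2l//.
by rewrite ler_nat.
Qed.

Lemma leq_parting_level n a b : (n <= parting_level u a b)%N =
  [&& (n <= h a)%N, (n <= h b)%N & u a b < B * expR (- (eps * n%:R))].
Proof.
rewrite andbA -leq_min; apply/idP/andP => [nl|[nm nu]]; last first.
  by rewrite /parting_level -ltnS in nm *; rewrite (bigop.bigmax_sup (Ordinal nm)).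
have i0P : u a b < B * expR (- (eps * (ord0 : 'I_(minn (h a) (h b)).+1)%:R)).
  by rewrite mulr0 oppr0 expR0 mulr1.
move: nl; rewrite /parting_level (bigop.bigmax_eq_arg ord0)//.
case: arg_maxnP => // i iu _ ni; split.
  by rewrite (leq_trans ni)// -ltnS ltn_ord.
exact: lt_le_trans iu (radius_decr ni).
Qed.

Lemma parting_level_profile : (forall a b, a = b -> u a b = 0) ->
  (forall a b, u a b = u b a) ->
  (forall a b c, u a c <= Num.max (u a b) (u b c)) ->
  tree_profile h (parting_level u).
Proof.
move=> u0 usym uultra; split.
- by move=> a b; rewrite /parting_level usym minnC.
- move=> a; apply/eqP; rewrite eqn_leq leq_parting_level leqnn u0//.
  have := leqnn (parting_level u a a); rewrite leq_parting_level => /and3P[-> _ _] /=.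
  by rewrite mulr_gt0 ?expR_gt0.
- by move=> a b; have := leqnn (parting_level u a b); rewrite leq_parting_level => /and3P[].
- move=> a b c; rewrite leq_parting_level.
  have := geq_minl (parting_level u a b) (parting_level u b c).
  have := geq_minr (parting_level u a b) (parting_level u b c).
  rewrite !leq_parting_level => /and3P[_ -> h2] /and3P[-> _ h1].
  by rewrite /= (le_lt_trans (uultra _ b _))// gt_max h1.
Qed.

(** If the points part before the end of their branches, then [u a b] is at
    least the radius at the next level, so the level is controlled by
    [ln (u a b)].  The conclusion is affine in the tree distance, so that
    it can be integrated. *)
Lemma parting_level_ln a b (K1 l : R) : 0 < u a b -> l <= ln (u a b) ->
  `|(h a)%:R - (h b)%:R| <= K1 ->
  (h a)%:R + (h b)%:R + 2 + 2 / eps * (l - ln B) <= K1 ->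
  eps / 2 * ((h a + h b - (parting_level u a b).*2)%N%:R - K1) + l <= ln (u a b).
Proof.
move=> u_gt0 lu K1a K1b.
set n := parting_level u a b.
have := leqnn n; rewrite leq_parting_level -/n => /and3P[na nb _].
rewrite natrB; last by lia.
rewrite natrD -mul2n natrM.
have [nm|mn] := leqP (minn (h a) (h b)) n.
  suff E : (h a)%:R + (h b)%:R - 2 * n%:R <= K1.
    have : eps / 2 * ((h a)%:R + (h b)%:R - 2 * n%:R - K1) <= 0.
      by rewrite pmulr_rle0 ?divr_gt0// subr_le0.
    by move: lu; lra.
  apply: le_trans K1a.
  have [ab|ba] := leqP (h a) (h b).
    have -> : n = h a by move: nm na; lia.
    by rewrite distrC; apply: le_trans (ler_norm _); lra.
  have -> : n = h b by move: nm nb; lia.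
  by apply: le_trans (ler_norm _); lra.
have : ~~ (n.+1 <= n)%N by rewrite ltnn.
rewrite {2}/n leq_parting_level !negb_and -leNgt.
have -> : (n < h a)%N by move: mn; lia.
have -> : (n < h b)%N by move: mn; lia.
rewrite /= -ler_ln ?posrE ?mulr_gt0 ?expR_gt0//.
rewrite lnM ?posrE ?expR_gt0// expRK -natr1 => lnu.
apply: le_trans lnu.
have : eps / 2 * ((h a)%:R + (h b)%:R + 2 + 2 / eps * (l - ln B)) <= eps / 2 * K1.
  by rewrite ler_wpM2l// divr_ge0// ltW.
have -> : eps / 2 * ((h a)%:R + (h b)%:R + 2 + 2 / eps * (l - ln B)) =
   eps / 2 * ((h a)%:R + (h b)%:R + 2) + l - ln B.
  by field; rewrite gt_eqF.
by lra.
Qed.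

End Fixed.
End BallTree.

Section Expectation.
Context {R : realType} (A Y : metricType R) (z : A -> Y) (B s D : R)
    (disp : measure_display) (Omega : measurableType disp)
    (P : probability Omega R) (u : Omega -> A -> A -> R).
Context (B0 : 0 < B) (s0 : 0 < s) (D0 : 0 < D).
Context (uP : random_ultrametric z B s D P u).
Context (h : A -> nat) (eps : R) (eps0 : 0 < eps).
Local Notation lev w := (parting_level h eps B (u w)).

Let uB w a b : u w a b < B. Proof. exact: ru_lt uP w a b. Qed.

Lemma random_profile w : tree_profile h (lev w).
Proof.
apply: parting_level_profile => //.
- by move=> a b ->; exact: (ru_xx uP).
- exact: (ru_sym uP).
- exact: (ru_ultra uP).
Qed.

Lemma parting_level_rv a b : finite_rv (fun w => lev w a b).
Proof.
split.
  apply: (@sub_finite_set _ _ `I_(h a).+1); last exact: finite_II.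
  by move=> _ [w _ <-]; rewrite /= ltnS; case: (random_profile w) => _ _ ->.
have mge n : measurable [set w | (n <= lev w a b)%N].
  rewrite (_ : [set w | _] = 
      [set w | [&& (n <= h a)%N, (n <= h b)%N &
                   u w a b < B * expR (- (eps * n%:R))]]).
    have [/andP[-> ->]|nab] := boolP ((n <= h a)%N && (n <= h b)%N).
      exact: (ru_measurable uP).
    rewrite (_ : [set w | _] = set0)//; rewrite -subset0 => w /= /and3P[h1 h2 _].
    by move: nab; rewrite h1 h2.
  by apply/seteqP; split=> w /=; rewrite leq_parting_level.
move=> n; rewrite (_ : _ @^-1` _ =
    [set w | (n <= lev w a b)%N] `&` ~` [set w | (n.+1 <= lev w a b)%N]).
  by apply: measurableI; [exact: mge|apply: measurableC; exact: mge].
apply/seteqP; split=> [w /= <-|w /= [h1 /negP h2]].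
  by rewrite leqnn; split=> //; rewrite ltnn.
by apply/eqP; rewrite eqn_leq h1 leqNgt h2.
Qed.

Lemma split_length_rv a b :
  finite_rv (fun w => (h a + h b - (lev w a b).*2)%N%:R : R).
Proof.
by apply: finite_rv_factor (parting_level_rv a b) _ => w w' ->.
Qed.

(** The first summand [K1] accounts for the tree distance in the worst case
    where [u] equals its lower bound [s * mdist (z a) (z b)]; the rest is the
    expected excess of the logarithm of [u] over that of the lower bound. *)
Lemma expected_split_length a b (K1 : R) : 0 <= K1 ->
  `|(h a)%:R - (h b)%:R| <= K1 ->
  (z a <> z b -> (h a)%:R + (h b)%:R + 2 +
    2 / eps * (ln (s * mdist (z a) (z b)) - ln B) <= K1) ->
  \int[P]_w (h a + h b - (lev w a b).*2)%N%:R <= K1 + 2 / eps * `|ln D|.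
Proof.
move=> K10 K1a K1b; have int := finite_rv_integrable P (split_length_rv a b).
have [zab|zab] := pselect (z a = z b).
  have E w : (h a + h b - (lev w a b).*2)%N%:R <= K1.
    have [_ _ _ _] := random_profile w; have := leqnn (minn (h a) (h b)).
    have : (minn (h a) (h b) <= lev w a b)%N.
      by rewrite leq_parting_level// (ru_xx uP)// geq_minl geq_minr mulr_gt0 ?expR_gt0.
    have := leqnn (lev w a b); rewrite leq_parting_level// => /and3P[la lb _] lm _.
    apply: le_trans K1a; have [ab|ba] := leqP (h a) (h b).
      have -> : (h a + h b - (lev w a b).*2 = h b - h a)%N by move: lm la lb; lia.
      by rewrite natrB// distrC ler_norm.
    have -> : (h a + h b - (lev w a b).*2 = h a - h b)%N by move: lm la lb; lia.
    by rewrite natrB ?ler_norm// ltnW.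
  apply: (@le_trans _ _ (\int[P]_w K1)).
    by apply: le_Rintegral => //; apply: finite_rv_integrable; exact: finite_rv_cst.
  rewrite expectation_cst.
  by rewrite lerDl mulr_ge0// divr_ge0// ltW.
have d0 : 0 < mdist (z a) (z b) by rewrite mdist_gt0; apply/eqP.
have sd0 : 0 < s * mdist (z a) (z b) by rewrite mulr_gt0.
pose l := ln (s * mdist (z a) (z b)).
(* [W w <= lne (u w a b)] says that the tree distance exceeds [K1] by at most
   [2 / eps] times the excess of the logarithm over its lower bound [l]. *)
pose W w : R := eps / 2 * ((h a + h b - (lev w a b).*2)%N%:R - K1) + l.
have WP : finite_rv W.
  by apply: finite_rv_factor (parting_level_rv a b) _ => w w'; rewrite /W => ->.
have [lu [lu_ae lu_int]] := ru_log uP a b.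
have : (\int[P]_w (W w)%:E <= \int[P]_w lu w)%E.
  apply: ae_le_integral_any => //.
  apply: filterS2 (ru_lower uP) lu_ae => w low ->.
  have u0 : 0 < u w a b by rewrite (lt_le_trans sd0).
  rewrite lne_EFin// lee_fin; apply: parting_level_ln => //; last exact: K1b.
  by rewrite ler_ln ?posrE.
move=> /le_trans/(_ lu_int); rewrite lne_EFin ?mulr_gt0//.
have -> : (\int[P]_w (W w)%:E = (\int[P]_w W w)%R%:E)%E.
  by rewrite /Rintegral fineK// integrable_fin_num// finite_rv_integrable.
rewrite lee_fin.
have -> : \int[P]_w W w =
    eps / 2 * (\int[P]_w (h a + h b - (lev w a b).*2)%N%:R - K1) + l.
  have -> : \int[P]_w W w = \int[P]_w
      (eps / 2 * (h a + h b - (lev w a b).*2)%N%:R + (l - eps / 2 * K1)).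
    by apply: eq_Rintegral => w _; rewrite /W; ring.
  rewrite expectation_affine; last exact: split_length_rv.
  by ring.
rewrite (mulrAC s) (lnM (x := s * _)) ?posrE// -/l [leRHS]addrC lerD2r => H.
rewrite -lerBlDl -(ler_pM2l (_ : 0 < eps / 2)) ?divr_gt0//.
apply: (le_trans H); rewrite mulrA [X in X * _](_ : _ = 1); last by field; rewrite gt_eqF.
by rewrite mul1r ler_norm.
Qed.

End Expectation.

(** * The space of summable sequences *)

Section BoundedMaps.
Context {R : realType}.

Definition bounded_map (V W : normedModType R) (f : V -> W) : Prop :=
  exists M : R, forall v, `|f v| <= M * `|v|.

Lemma bounded_map_gt0 (V W : normedModType R) (f : V -> W) : bounded_map f ->
  exists2 M : R, 0 < M & forall v, `|f v| <= M * `|v|.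
Proof.
move=> [M fM]; exists (`|M| + 1); first by rewrite ltr_wpDl.
move=> v; rewrite (le_trans (fM v))// ler_wpM2r//.
by rewrite (le_trans (ler_norm _))// lerDl.
Qed.

Lemma bounded_map_continuous (V W : normedModType R) (f : {linear V -> W}) :
  bounded_map f -> continuous f.
Proof.
move=> /bounded_map_gt0[M M0 fM]; apply: bounded_linear_continuous.
apply/linear_boundedP; near=> N => v; rewrite (le_trans (fM v))// ler_wpM2r//.
Unshelve. all: by end_near. Qed.

Lemma bounded_isomorphic (V W : normedModType R) (f : V -> W) (g : W -> V) :
  linear f -> linear g -> bounded_map f -> bounded_map g ->
  cancel f g -> cancel g f -> isomorphic V W.
Proof.
move=> lf lg bf bg fK gK.
pose F : {linear V -> W} := HB.pack f (GRing.isLinear.Build R V W *:%R f lf).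
pose G : {linear W -> V} := HB.pack g (GRing.isLinear.Build R W V *:%R g lg).
exists F, G; split => //.
- exact: (@bounded_map_continuous _ _ F).
- exact: (@bounded_map_continuous _ _ G).
Qed.

End BoundedMaps.

Section Ell1Theory.
Context {R : realType}.
Implicit Types (u v : ell1 R) (f : nat -> R).

Lemma ell1_eq u v : (forall n, u n = v n) -> u = v.
Proof. by move=> uv; apply: val_inj; apply/funext. Qed.

Lemma ell1DE u v n : (u + v) n = u n + v n. Proof. by []. Qed.

Lemma ell1ZE (a : R) u n : (a *: u) n = a * u n. Proof. by []. Qed.

Lemma ell1_sum_le u n : \sum_(i < n) `|u i| <= `|u|.
Proof.
rewrite -(big_mkord xpredT (fun i => `|u i|)).
apply: nondecreasing_cvgn_le; last exact: ell1_cvg.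
by apply/nondecreasing_seqP => m; rewrite -subr_ge0 seriesSB.
Qed.

Lemma ell1_norm_le u (M : R) : (forall n, \sum_(i < n) `|u i| <= M) -> `|u| <= M.
Proof.
move=> uM; apply: limr_le; first exact: ell1_cvg.
by apply: nearW => n; rewrite /series/= big_mkord.
Qed.

Definition ell1_of f : ell1 R := insubd (0 : ell1 R) (f : nat -> R^o).

Lemma ell1_ofE f (M : R) : (forall n, \sum_(i < n) `|f i| <= M) ->
  forall i, ell1_of f i = f i.
Proof.
move=> fM i; rewrite /ell1_of insubdK//; apply/asboolP.
apply: nondecreasing_is_cvgn.
  by apply/nondecreasing_seqP => m; rewrite -subr_ge0 seriesSB.
by exists M => _ [n _ <-]; rewrite /series/= big_mkord.
Qed.

Lemma ell1_of_norm f (M : R) : (forall n, \sum_(i < n) `|f i| <= M) ->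
  `|ell1_of f| <= M.
Proof.
move=> fM; apply: ell1_norm_le => n.
by under eq_bigr => i _ do rewrite (ell1_ofE fM).
Qed.

(** Summability does not depend on the order of the terms; this is what
    allows [ell1] to be cut into blocks. *)
Lemma ell1_sum_uniq_le u (s : seq nat) : uniq s -> \sum_(i <- s) `|u i| <= `|u|.
Proof.
move=> us; pose n := (\max_(i <- s) i).+1.
have sn i : i \in s -> (i < n)%N by move=> si; rewrite ltnS; exact: leq_bigmax_seq.
apply: le_trans (ell1_sum_le u n).
rewrite -(big_mkord xpredT (fun i => `|u i|)) /index_iota subn0.
have /(perm_big _) <- : perm_eq [seq i <- iota 0 n | i \in s] s.
  apply: uniq_perm => //; first by rewrite filter_uniq ?iota_uniq.
  by move=> i; rewrite mem_filter mem_iota add0n; case: (boolP (i \in s)) => //= /sn ->.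
rewrite big_filter [leRHS](bigID (mem s))/= lerDl.
by apply: sumr_ge0 => ? _.
Qed.

End Ell1Theory.

Section Blocks.
Context {R : realType} (pair : nat * nat -> nat) (unpair : nat -> nat * nat).
Context (pairK : cancel pair unpair) (unpairK : cancel unpair pair).
Implicit Types (u v : ell1 R) (B : nat -> ell1 R).

(** [block n u] is the [n]-th row of [u], laid out as a double sequence by
    [pair], and [glue] is the inverse operation; they realize [ell1] as the
    space of summable sequences of elements of [ell1]. *)
Definition block n u : ell1 R := ell1_of (fun k => u (pair (n, k))).

Definition glue B : ell1 R :=
  ell1_of (fun i => B (unpair i).1 (unpair i).2).

Lemma block_sum_le u m n :
  \sum_(i < m) \sum_(j < n) `|u (pair (val i, val j))| <= `|u|.
Proof.
rewrite pair_big/= -(big_map (fun ij : 'I_m * 'I_n => pair (val ij.1, val ij.2))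
   xpredT (fun k => `|u k|)).
apply: ell1_sum_uniq_le; rewrite map_inj_uniq ?index_enum_uniq//.
by move=> [i j] [i' j'] /(can_inj pairK)[/val_inj-> /val_inj->].
Qed.

Lemma blockE n u k : block n u k = u (pair (n, k)).
Proof.
apply: (@ell1_ofE _ _ `|u|) => m.
apply: le_trans (block_sum_le u n.+1 m).
by rewrite big_ord_recr/= lerDr sumr_ge0// => i _; exact: sumr_ge0.
Qed.

Lemma block_eq u v : (forall n, block n u = block n v) -> u = v.
Proof.
move=> uv; apply: ell1_eq => i; rewrite -(unpairK i); case: (unpair i) => n k.
by rewrite -!blockE uv.
Qed.

Lemma block_linear n : linear (block n).
Proof. by move=> a u v; apply: ell1_eq => k; rewrite ell1DE ell1ZE !blockE. Qed.

Lemma sum_block_le u n : \sum_(i < n) `|block i u| <= `|u|.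
Proof.
pose S m := \sum_(i < n) series (fun k => `|block i u k|) m.
have : S @ \oo --> \sum_(i < n) `|block i u|.
  rewrite /S; elim: n {S} => [|n IH].
    by under eq_fun do rewrite big_ord0; rewrite big_ord0; exact: cvg_cst.
  under eq_fun do rewrite big_ord_recr; rewrite big_ord_recr/=.
  by apply: cvgD; [exact: IH|exact: ell1_cvg].
move=> cS; rewrite -(cvg_lim _ cS)//; apply: limr_le; first by apply/cvg_ex; eexists; exact: cS.
apply: nearW => m; rewrite /S; apply: le_trans (block_sum_le u n m).
apply: ler_sum => i _; rewrite /series/= big_mkord.
by apply: ler_sum => j _; rewrite blockE.
Qed.

Section Glue.
Context (B : nat -> ell1 R) (M : R) (BM : forall n, \sum_(i < n) `|B i| <= M).

Lemma glue_sum_le n : \sum_(i < n) `|B (unpair i).1 (unpair i).2| <= M.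
Proof.
pose m := (\max_(i < n) (unpair i).1).+1; pose k := (\max_(i < n) (unpair i).2).+1.
apply: le_trans (BM m).
apply: (@le_trans _ _ (\sum_(a < m) \sum_(b < k) `|B a b|)); last first.
  by apply: ler_sum => a _; exact: ell1_sum_le.
have im (i : 'I_n) : ((unpair i).1 < m)%N by rewrite ltnS (leq_bigmax i).
have ik (i : 'I_n) : ((unpair i).2 < k)%N by rewrite ltnS (leq_bigmax i).
pose h (i : 'I_n) : 'I_m * 'I_k := (Ordinal (im i), Ordinal (ik i)).
have hinj : injective h.
  move=> i j [h1 h2]; apply: val_inj; apply: (can_inj unpairK).
  by move: h1 h2; case: (unpair i) => ? ?; case: (unpair j) => ? ? /= -> ->.
rewrite pair_big/= [leRHS](bigID (fun ab => ab \in codom h))/=.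
rewrite -[X in X + _]big_uniq/=; last by rewrite map_inj_uniq// enum_uniq.
rewrite /codom big_map /= big_enum/= lerDl; apply: sumr_ge0 => ? _; exact: normr_ge0.
Qed.

Lemma block_glue n : block n (glue B) = B n.
Proof.
apply: ell1_eq => k; rewrite blockE (ell1_ofE glue_sum_le).
by rewrite pairK.
Qed.

Lemma glue_norm_le : `|glue B| <= M.
Proof. exact: (ell1_of_norm glue_sum_le). Qed.

End Glue.
End Blocks.

Lemma scaler_comb3 (R : pzRingType) (V : lmodType R) (a : R) (x x' y y' z z' : V) :
  a *: x + x' + (a *: y + y') + (a *: z + z') =
  a *: (x + y + z) + (x' + y' + z').
Proof.
rewrite (scalerDr a (x + y)) (scalerDr a x).
by rewrite (addrACA (a *: x)) (addrACA (a *: x + a *: y)).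
Qed.

Section Decomposition.
Context {R : realType}.
Local Notation E := (ell1 R).

Lemma pair_bijection : exists (pair : nat * nat -> nat) unpair,
  cancel pair unpair /\ cancel unpair pair.
Proof.
have [f [g fK gK]] : exists f : [set: nat * nat] -> [set: nat], bijective f.
  exact/card_bijP/card_nat2.
exists (fun ij => val (f (exist _ ij (in_setT ij)))).
exists (fun n => val (g (exist _ n (in_setT n)))); split=> x /=.
  rewrite [X in g X](_ : _ = f (exist _ x (in_setT x))) ?fK//.
  exact: val_inj.
rewrite [X in f X](_ : _ = g (exist _ x (in_setT x))) ?gK//.
exact: val_inj.
Qed.

(** Pelczynski's decomposition, with the infinite swindle written out.  Let
    [P := I \o r] be the projection of [ell1] on the copy of [V], and
    [Q := id - P].  Sending [v] and a sequence [z] of blocks to the blocks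
    [I v + Q z_0, P z_0 + Q z_1, P z_1 + Q z_2, ...] identifies the direct sum
    of [V] and [ell1] with [ell1]: the inverse reads [z_n] off as
    [Q w_n + P w_(n+1)].  On the other hand [V] absorbs such a summand:
    the coordinates [q v] of [v] on the copy [J] of [ell1] are cut into
    blocks, the first of which takes the place of [q v] in [rest v], while the
    others are the sequence [z]. *)
Lemma pelczynski (V : normedModType R) (I : {linear V -> E}) (r : {linear E -> V})
    (J : {linear E -> V}) (q : {linear V -> E}) :
  bounded_map I -> bounded_map r -> bounded_map J -> bounded_map q ->
  cancel I r -> cancel J q -> isomorphic V E.
Proof.
move=> /bounded_map_gt0[cI cI0 bI] /bounded_map_gt0[cr cr0 br].
move=> /bounded_map_gt0[cJ cJ0 bJ] /bounded_map_gt0[cq cq0 bq] IK JK.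
have [pair [unpair [pK uK]]] := pair_bijection.
pose blk n : {linear E -> E} := HB.pack (block pair n)
  (GRing.isLinear.Build R E E *:%R _ (block_linear pK n)).
have blk_eq (u v : E) : (forall n, blk n u = blk n v) -> u = v by exact: (block_eq pK uK).
have sum_blk u n : \sum_(i < n) `|blk i u| <= `|u| by exact: (sum_block_le pK).
pose P (u : E) : E := I (r u); pose Q u := u - P u.
have PD u v : P (u + v) = P u + P v by rewrite /P !linearD.
have QD u v : Q (u + v) = Q u + Q v by rewrite /Q PD opprD addrACA.
have PZ a u : P (a *: u) = a *: P u by rewrite /P !linearZ.
have QZ a u : Q (a *: u) = a *: Q u by rewrite /Q PZ scalerBr.
have PP u : P (P u) = P u by rewrite /P IK.
have PQ u : P (Q u) = 0 by rewrite /Q /P linearB/= linearB/= IK subrr.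
have QP u : Q (P u) = 0 by rewrite /Q PP subrr.
have QQ u : Q (Q u) = Q u by rewrite {1}/Q PQ subr0.
have PI v : P (I v) = I v by rewrite /P IK.
have QI v : Q (I v) = 0 by rewrite /Q PI subrr.
have rQ u : r (Q u) = 0 by rewrite /Q linearB/= /P IK subrr.
have PDQ u : P u + Q u = u by rewrite /Q addrC subrK.
pose cP := cI * cr; have cP0 : 0 < cP by rewrite mulr_gt0.
have bP u : `|P u| <= cP * `|u|.
  by rewrite (le_trans (bI _))// -mulrA ler_wpM2l// ltW.
have bQ u : `|Q u| <= (1 + cP) * `|u|.
  by rewrite (le_trans (ler_normB _ _))// mulrDl mul1r lerD2l.
have c1 : 0 <= 1 + cP by rewrite addr_ge0// ltW.
have c2 : 0 <= 1 + cP + cP by rewrite addr_ge0// ltW.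
have cqr : 0 <= cq * cr by rewrite mulr_ge0// ltW.
have PE u : I (r u) = P u by [].
clearbody Q P.
pose rest v := v - J (q v) + J (blk 0%N (q v)).
(* The blocks of the image of [v]; the sequence [z] starts at block 1. *)
pose B v n := if n is k.+1 then P (blk n (q v)) + Q (blk n.+1 (q v))
              else I (rest v) + Q (blk 1%N (q v)).
have rest_lin : linear rest.
  by move=> a u v; rewrite /rest !linearP; exact: scaler_comb3.
have B_lin a u v n : B (a *: u + v) n = a *: B u n + B v n.
  case: n => [|n]; rewrite /B ?rest_lin !linearP/= !(PD, QD, PZ, QZ).
    by rewrite (scalerDr a (I _)) addrACA.
  by rewrite (scalerDr a (P _)) addrACA.
pose cR := 1 + cJ * cq + cJ * cq.
have cR0 : 0 <= cR by rewrite !addr_ge0// mulr_ge0// ltW.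
have cIR : 0 <= cI * cR by rewrite mulr_ge0// ltW.
have brest v : `|rest v| <= cR * `|v|.
  rewrite (le_trans (ler_normD _ _))// /cR mulrDl lerD//.
    rewrite (le_trans (ler_normB _ _))// mulrDl mul1r lerD2l.
    by rewrite (le_trans (bJ _))// -mulrA ler_wpM2l// ltW.
  rewrite (le_trans (bJ _))// -mulrA ler_wpM2l ?(ltW cJ0)//.
  have := sum_blk (q v) 1%N; rewrite big_ord1 => h.
  exact: le_trans h (bq v).
have bB v n : \sum_(i < n) `|B v i| <= (cI * cR + (1 + cP + cP) * cq) * `|v|.
  pose S0 i := if i is 0%N then cI * cR * `|v| else 0.
  have step i : `|B v i| <= S0 i +
      (cP * `|blk i (q v)| + (1 + cP) * `|blk i.+1 (q v)|).
    rewrite /S0.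
    case: i => [|i] /=; rewrite (le_trans (ler_normD _ _))//.
      rewrite lerD//; first by rewrite (le_trans (bI _))// -mulrA ler_wpM2l// ltW.
      by rewrite (le_trans (bQ _))// lerDr mulr_ge0// ltW.
    by rewrite add0r lerD.
  apply: (@le_trans _ _ (\sum_(i < n) (S0 i +
    (cP * `|blk i (q v)| + (1 + cP) * `|blk i.+1 (q v)|)))).
    by apply: ler_sum => i _; exact: step.
  rewrite big_split/= mulrDl lerD//.
    case: n => [|n]; first by rewrite big_ord0 mulr_ge0.
    by rewrite big_ord_recl/= big1 ?addr0.
  rewrite big_split/=.
  have sumS : \sum_(i < n) `|blk i.+1 (q v)| <= `|q v|.
    apply: le_trans (sum_blk (q v) n.+1); rewrite big_ord_recl.
    by rewrite lerDr.
  have h1 : \sum_(i < n) cP * `|blk i (q v)| <= cP * `|q v|.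
    by rewrite -mulr_sumr; exact: ler_wpM2l (ltW cP0) _ _ (sum_blk _ _).
  have h2 : \sum_(i < n) (1 + cP) * `|blk i.+1 (q v)| <= (1 + cP) * `|q v|.
    by rewrite -mulr_sumr; exact: ler_wpM2l c1 _ _ sumS.
  apply: (le_trans (lerD h1 h2)); rewrite -mulrDl addrC -mulrA.
  exact: ler_wpM2l c2 _ _ (bq v).
pose F v := glue unpair (B v).
have blkF v n : blk n (F v) = B v n by exact: (block_glue pK uK (bB v)).
(* The blocks of [q v] recovered from the image [w] of [v]. *)
pose y w n := if n is k.+1 then Q (blk k w) + P (blk n w) else q (r (blk 0%N w)).
have y_lin a u v n : y (a *: u + v) n = a *: y u n + y v n.
  case: n => [|n]; rewrite /y !linearP//= !(PD, QD, PZ, QZ).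
  by rewrite (scalerDr a (Q _)) addrACA.
have by_ w n : \sum_(i < n) `|y w i| <= (cq * cr + (1 + cP + cP)) * `|w|.
  case: n => [|n]; first by rewrite big_ord0 mulr_ge0// addr_ge0.
  rewrite big_ord_recl/= mulrDl lerD//.
    rewrite (le_trans (bq _))// -mulrA ler_wpM2l ?(ltW cq0)//.
    rewrite (le_trans (br _))// ler_wpM2l ?(ltW cr0)//.
    by have := sum_blk w 1%N; rewrite big_ord1.
  apply: (@le_trans _ _ (\sum_(i < n) (`|Q (blk i w)| + `|P (blk i.+1 w)|))).
    by apply: ler_sum => i _; exact: ler_normD.
  rewrite big_split/= [leRHS]mulrDl; apply: lerD.
    apply: (@le_trans _ _ (\sum_(i < n) (1 + cP) * `|blk i w|)).
      by apply: ler_sum => i _; exact: bQ.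
    by rewrite -mulr_sumr; exact: ler_wpM2l c1 _ _ (sum_blk _ _).
  apply: (@le_trans _ _ (\sum_(i < n) cP * `|blk i.+1 w|)).
    by apply: ler_sum => i _; exact: bP.
  rewrite -mulr_sumr; apply: (ler_wpM2l (ltW cP0)).
  apply: le_trans (sum_blk w n.+1); rewrite big_ord_recl.
  by rewrite lerDr.
pose gy w := glue unpair (y w).
have blky w n : blk n (gy w) = y w n by exact: (block_glue pK uK (by_ w)).
have gy_lin : linear gy.
  move=> a u v; apply: blk_eq => n; apply: (etrans (blky _ n)).
  rewrite y_lin -(blky u n) -(blky v n).
  exact: (esym (linearP (blk n) a (gy u) (gy v))).
pose G w := r (blk 0%N w) - J (y w 0%N) + J (gy w).
have qG w : q (G w) = gy w.
  by rewrite /G linearD linearB/= !JK /y subrr add0r.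
have restG w : rest (G w) = r (blk 0%N w).
  by rewrite /rest qG blky /G addrK subrK.
apply: (@bounded_isomorphic _ _ _ F G).
- move=> a u v; apply: blk_eq => n; apply: (etrans (blkF _ n)).
  rewrite B_lin -(blkF u n) -(blkF v n).
  exact: (esym (linearP (blk n) a (F u) (F v))).
- by move=> a u v; rewrite /G gy_lin y_lin !linearP; exact: scaler_comb3.
- exists (cI * cR + (1 + cP + cP) * cq) => v.
  exact: (glue_norm_le uK (bB v)).
- exists (cr + cJ * (cq * cr) + cJ * (cq * cr + (1 + cP + cP))) => w.
  have b0 : `|blk 0%N w| <= `|w|.
    by have := sum_blk w 1%N; rewrite big_ord1.
  have br0 : `|r (blk 0%N w)| <= cr * `|w|.
    by rewrite (le_trans (br _))// ler_wpM2l// ltW.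
  rewrite (le_trans (ler_normD _ _))// mulrDl lerD//.
    rewrite (le_trans (ler_normB _ _))// mulrDl lerD// (le_trans (bJ _))//.
    rewrite -!mulrA ler_wpM2l ?(ltW cJ0)// (le_trans (bq _))//.
    by rewrite ler_wpM2l// ltW.
  rewrite (le_trans (bJ _))// -mulrA ler_wpM2l ?(ltW cJ0)//.
  exact: (glue_norm_le uK (by_ w)).
- move=> v.
  have rF : r (blk 0%N (F v)) = rest v by rewrite blkF /= linearD/= IK rQ addr0.
  have y0 : y (F v) 0%N = blk 0%N (q v).
    by rewrite /y rF /rest linearD linearB/= !JK subrr add0r.
  have yE : gy (F v) = q v.
    apply: blk_eq => n; rewrite blky; case: n => [|n]; first exact: y0.
    rewrite /y !blkF; case: n => [|n]; rewrite /B !(QD, PD) ?QI ?QP ?QQ ?PP ?PQ.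
      by rewrite add0r addr0 addrC PDQ.
    by rewrite add0r addr0 addrC PDQ.
  by rewrite /G yE y0 rF /rest addrK subrK.
- move=> w; apply: blk_eq => n; rewrite blkF /B restG qG !blky.
  by case: n => [|n]; rewrite /y !(QD, PD) QP QQ ?PP ?PQ ?add0r addr0 ?PE PDQ.
Qed.

End Decomposition.

(** * Lipschitz-free spaces *)

Section Pairing.
Context {R : realType}.
Implicit Types (u v : ell1 R) (g h : nat -> R).

(** The duality pairing of [ell1] with bounded sequences. *)
Definition pairing u g : R := limn (series (fun k => u k * g k)).

Lemma pairing_cvg u g (M : R) : (forall k, `|g k| <= M) ->
  cvgn (series (fun k => u k * g k)).
Proof.
move=> gM; apply: normed_cvg.
apply: (@series_le_cvg _ _ (M *: (fun k => `|u k|))) => [k|k|k|].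
- exact: normr_ge0.
- by rewrite mulr_ge0// (le_trans _ (gM k)).
- by rewrite /= normrM mulrC ler_wpM2r.
- exact/is_cvg_seriesZ/ell1_cvg.
Qed.

Lemma pairing_tail u g (M : R) n : (forall k, `|g k| <= M) ->
  `|pairing u g - \sum_(k < n) u k * g k| <= M * (`|u| - \sum_(k < n) `|u k|).
Proof.
move=> gM; have M0 : 0 <= M by rewrite (le_trans _ (gM 0%N)).
have cv := @pairing_cvg u g M gM.
have cv' : (fun m => `|series (fun k => u k * g k) m - \sum_(k < n) u k * g k|) @ \oo
    --> `|pairing u g - \sum_(k < n) u k * g k|.
  by apply: cvg_norm; apply: cvgB; [exact: cv|exact: cvg_cst].
rewrite -(cvg_lim _ cv')//; apply: limr_le; first by apply/cvg_ex; eexists; exact: cv'.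
near=> m; have nm : (n <= m)%N by near: m; exact: nbhs_infty_ge.
rewrite /series/= -(big_mkord xpredT (fun k : nat => u k * g k)) (big_cat_nat (leq0n n) nm)//=.
rewrite [X in `|X - _|]addrC addrK -(big_mkord xpredT (fun k : nat => `|u k|)).
apply: (@le_trans _ _ (M * \sum_(n <= k < m) `|u k|)).
  rewrite (le_trans (ler_norm_sum _ _ _))// mulr_sumr ler_sum// => k _.
  by rewrite normrM mulrC ler_wpM2r.
rewrite ler_wpM2l// lerBrDr addrC -big_cat_nat//=.
by rewrite big_mkord ell1_sum_le.
Unshelve. all: by end_near. Qed.

Lemma pairing_le u g (M : R) : (forall k, `|g k| <= M) ->
  `|pairing u g| <= M * `|u|.
Proof. by move=> /(@pairing_tail u g M 0%N); rewrite !big_ord0 !subr0. Qed.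

Lemma pairing_linearl (a : R) u v g (M : R) : (forall k, `|g k| <= M) ->
  pairing (a *: u + v) g = a * pairing u g + pairing v g.
Proof.
move=> gM; have cu := @pairing_cvg u g M gM; have cv := @pairing_cvg v g M gM.
rewrite /pairing.
transitivity (limn (series (a *: (fun k : nat => u k * g k) + (fun k : nat => v k * g k)))).
  by congr (limn (series _)); apply/funext => k; rewrite ell1DE ell1ZE mulrDl -mulrA.
rewrite lim_seriesD//; last exact: is_cvg_seriesZ.
by rewrite lim_seriesZ.
Qed.

Lemma pairing_linearr (a : R) u g h (M N : R) :
  (forall k, `|g k| <= M) -> (forall k, `|h k| <= N) ->
  pairing u (fun k => a * g k + h k) = a * pairing u g + pairing u h.
Proof.
move=> gM hN; have cg := @pairing_cvg u g M gM; have ch := @pairing_cvg u h N hN.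
rewrite /pairing.
transitivity (limn (series (a *: (fun k : nat => u k * g k) + (fun k : nat => u k * h k)))).
  by congr (limn (series _)); apply/funext => k; rewrite mulrDr mulrCA.
rewrite lim_seriesD//; last exact: is_cvg_seriesZ.
by rewrite lim_seriesZ.
Qed.

Lemma pairing_finite u g n l :
  (forall m, (n <= m)%N -> \sum_(k < m) u k * g k = l) -> pairing u g = l.
Proof.
move=> H; apply: cvg_lim => //; apply: cvg_near_cst.
by exists n => // m /= nm; rewrite /series/= big_mkord H.
Qed.

End Pairing.

Section DualNorm.
Context {R : realType} (V : normedModType R).
Implicit Types (phi psi : dual V) (v : V).

Lemma dual_fun0 phi : phi 0 = 0.
Proof. by rewrite -(scale0r (0 : V)) dual_funZ mul0r. Qed.

Lemma dual_linP phi (a : R) u v : phi (a *: u + v) = a * phi u + phi v.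
Proof. by have /asboolP[lphi _] := dual_mem phi; exact: lphi. Qed.

Lemma dual_sum phi n (v : 'I_n -> V) : phi (\sum_(i < n) v i) = \sum_(i < n) phi (v i).
Proof.
apply: (big_morph (phi : V -> R)); last exact: dual_fun0.
by move=> x y; rewrite -[x]scale1r dual_linP mul1r scale1r.
Qed.

Lemma dual_le phi v : `|phi v| <= `|phi| * `|v|.
Proof.
have [->|v0] := eqVneq v 0.
  by rewrite dual_fun0 !normr0 mulr0.
have := @le_dual_norm1 _ _ phi (`|v|^-1 *: v).
rewrite normrZ normfV normr_id mulVf ?normr_eq0// lexx => /(_ isT).
rewrite dual_funZ normrM normfV normr_id mulrC ler_pdivrMr ?normr_gt0//.
Qed.

Lemma dual_norm_le_bound phi (M : R) : 0 <= M ->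
  (forall v, `|phi v| <= M * `|v|) -> `|phi| <= M.
Proof.
move=> M0 phiM; apply: dual_norm_le => v v1.
by rewrite (le_trans (phiM v))// ler_piMr.
Qed.

Lemma dual_ext phi psi : (forall v, phi v = psi v) -> phi = psi.
Proof. by move=> E; apply: val_inj; apply/funext. Qed.

Lemma mem_dual_pred (f : V -> R^o) (M : R) : linear f ->
  (forall v, `|f v| <= M * `|v|) -> f \in @dual_pred R V.
Proof.
move=> lf fM; apply/asboolP; split=> //.
pose F : {linear V -> R^o} := HB.pack f (GRing.isLinear.Build R V R^o *:%R f lf).
by apply: (@bounded_map_continuous _ _ _ F); exists M.
Qed.

End DualNorm.

Section LipschitzFree.
Context {R : realType} {A : metricType R} (a0 : A).
Local Notation Lip0 := (Lip0 a0).
Local Notation D := (dual Lip0).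
Implicit Types (f : Lip0) (mu : D) (u : ell1 R).

Lemma Lip0_le f x y : `|f x - f y| <= `|f| * mdist x y.
Proof. by have [_] := lip_normP f; exact. Qed.

Lemma Lip0_base f : f a0 = 0.
Proof. by have /asboolP[] := lip0_mem f. Qed.

Lemma Lip0_sumE n (g : 'I_n -> Lip0) x : (\sum_(i < n) g i) x = \sum_(i < n) g i x.
Proof. by elim/big_ind2: _ => // f1 r1 f2 r2 <- <-. Qed.

Section Analysis.
Context (c : nat -> A -> R) (K : R) (K0 : 0 <= K) (c_base : forall k, c k a0 = 0).
Context (c_lip : forall n x y, \sum_(k < n) `|c k x - c k y| <= K * mdist x y).

Lemma coordinate_lip0 k : (c k : A -> R^o) \in @lip0_pred R A a0.
Proof.
apply/asboolP; split=> //; exists K; split=> // x y.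
by apply: le_trans (c_lip k.+1 x y); rewrite big_ord_recr/= lerDr sumr_ge0.
Qed.

Definition coordinate k : Lip0 := MkLip0 (coordinate_lip0 k).

(** Test the functional on the combination of the coordinates with its own
    signs: the hypothesis says that such combinations are [K]-Lipschitz. *)
Lemma coordinates_sum_le mu n : \sum_(k < n) `|mu (coordinate k)| <= K * `|mu|.
Proof.
pose g : Lip0 := \sum_(k < n) Num.sg (mu (coordinate k)) *: coordinate k.
have -> : \sum_(k < n) `|mu (coordinate k)| = mu g.
  by rewrite dual_sum; apply: eq_bigr => k _; rewrite dual_funZ normrEsg.
rewrite (le_trans (ler_norm _))// (le_trans (dual_le _ _))// mulrC ler_wpM2r//.
apply: lip_norm_le; split=> // x y; rewrite /g !Lip0_sumE -sumrB.
apply: le_trans (c_lip n x y); rewrite (le_trans (ler_norm_sum _ _ _))//.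
apply: ler_sum => k _; rewrite -[_ - _]/(_ * c k x - _ * c k y) -mulrBr normrM.
by rewrite ler_piMl// normr_sg lern1; case: eqP.
Qed.

(** A family of functions whose differences are summable, uniformly with
    respect to the distance, maps functionals boundedly to [ell1]. *)
Definition analysis mu : ell1 R := ell1_of (fun k => mu (coordinate k)).

Lemma analysisE mu k : analysis mu k = mu (coordinate k).
Proof. exact: ell1_ofE (coordinates_sum_le mu) k. Qed.

Lemma analysis_linear : linear analysis.
Proof. by move=> a mu nu; apply: ell1_eq => k; rewrite ell1DE ell1ZE !analysisE. Qed.

Lemma analysis_le mu : `|analysis mu| <= K * `|mu|.
Proof. exact: ell1_of_norm (coordinates_sum_le mu). Qed.

End Analysis.

Section Synthesis.
Context (x y : nat -> A).

(** When [x k = y k] the quotient is zero by convention, so that degenerate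
    pairs may be enumerated together with the others. *)
Definition molecule k (f : A -> R) : R := (f (y k) - f (x k)) / mdist (x k) (y k).

Lemma molecule_le k f : `|molecule k f| <= `|f|.
Proof.
rewrite /molecule normrM normfV (ger0_norm (mdist_ge0 _ _)).
have [->|xy] := eqVneq (x k) (y k); first by rewrite mdistxx invr0 mulr0.
by rewrite ler_pdivrMr ?mdist_gt0// metric_sym Lip0_le.
Qed.

Lemma moleculeP k (a : R) f g : molecule k (a *: f + g) = a * molecule k f + molecule k g.
Proof.
rewrite /molecule -[(a *: f + g) _]/(a * f _ + g _) -[(a *: f + g) (x k)]/(a * f _ + g _).
by ring.
Qed.

Lemma synthesis_dual u : (fun f => pairing u (fun k => molecule k f) : R^o)
  \in @dual_pred R Lip0.
Proof.
apply: (@mem_dual_pred _ _ _ `|u|) => [a f g|f]; last first.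
  by rewrite mulrC; apply: pairing_le => k; exact: molecule_le.
under eq_fun do rewrite moleculeP.
by apply: pairing_linearr => k; exact: molecule_le.
Qed.

Definition synthesis u : D := Dual (synthesis_dual u).

Lemma synthesisE u f : synthesis u f = pairing u (fun k => molecule k f).
Proof. by []. Qed.

Lemma synthesis_linear : linear synthesis.
Proof.
move=> a u v; apply: dual_ext => f; rewrite synthesisE.
exact: (pairing_linearl _ _ _ (fun k => molecule_le k f)).
Qed.

Lemma synthesis_le u : `|synthesis u| <= `|u|.
Proof.
apply: dual_norm_le_bound => // f; rewrite mulrC.
by apply: pairing_le => k; exact: molecule_le.
Qed.

Lemma synthesis_closed_span u :
  synthesis u \in @closed_span_pred R D (range (@eval_dual R A a0)).
Proof.
apply/asboolP => B /nbhs_ballP[e /= e0 eB].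
pose S n : D := \sum_(k < n) (u k / mdist (x k) (y k)) *:
   (1 *: eval_dual a0 (y k) + (-1) *: eval_dual a0 (x k)).
have SE n f : S n f = \sum_(k < n) u k * molecule k f.
  rewrite /S; elim/big_ind2: _ => // [_ r1 _ r2 <- <-//|k _].
  rewrite -[LHS]/(_ * (1 * f (y k) + -1 * f (x k))) /molecule; ring.
have [n Hn] : exists n : nat, `|u| - \sum_(k < n) `|u k| < e.
  have : (fun n : nat => \sum_(k < n) `|u k|) @ \oo --> `|u|.
    rewrite (_ : (fun _ => _) = series (fun k => `|u k|)); first exact: ell1_cvg.
    by apply/funext => m; rewrite /series/= big_mkord.
  move=> /cvgrPdist_lt/(_ e e0)[n _ /(_ n (leqnn n))] /= H; exists n.
  exact: le_lt_trans (ler_norm _) H.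
exists (S n); split; last first.
  apply: eB; rewrite -ball_normE /ball_/=; apply: le_lt_trans Hn.
  apply: dual_norm_le_bound => [|f]; first by rewrite subr_ge0 ell1_sum_le.
  have -> : (synthesis u - S n : D) f = synthesis u f - S n f by [].
  rewrite SE synthesisE mulrC.
  by apply: pairing_tail => k; exact: molecule_le.
have span_eval a : lin_span (range (@eval_dual R A a0)) (eval_dual a0 a).
  exists 1%N, (fun=> 1), (fun=> eval_dual a0 a); split; first by move=> _; exists a.
  by rewrite big_ord1 scale1r.
rewrite /S; elim/big_ind: _ => [|p q pS qS|k _]; first exact: lin_span0.
  by rewrite -[p]scale1r; exact: lin_spanP.
rewrite -[X in lin_span _ X]addr0; apply: lin_spanP; last exact: lin_span0.
apply: lin_spanP => //; rewrite -[X in lin_span _ X]addr0; apply: lin_spanP => //.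
exact: lin_span0.
Qed.


Definition synthesis_LF u : LF a0 := MkClosedSpan (synthesis_closed_span u).

Lemma synthesis_LF_linear : linear synthesis_LF.
Proof. by move=> a u v; apply: val_inj; exact: synthesis_linear. Qed.

End Synthesis.

Section Factorization.
Context (c : nat -> A -> R) (K : R) (K0 : 0 <= K) (c_base : forall k, c k a0 = 0).
Context (c_lip : forall n x y, \sum_(k < n) `|c k x - c k y| <= K * mdist x y).
Context (x y : nat -> A).
Local Notation analysis := (analysis K0 c_base c_lip).

Lemma analysis_synthesis :
  (forall j k, molecule x y k (c j) = (j == k)%:R) ->
  cancel (synthesis x y) analysis.
Proof.
move=> biorth u; apply: ell1_eq => j; rewrite analysisE.
apply: (@pairing_finite _ _ _ j.+1) => m jm.
rewrite (bigD1 (Ordinal jm))//= big1 => [|k kj]; last first.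
  rewrite -[molecule _ _ _ _]/(molecule x y k (c j)) biorth.
  by rewrite eq_sym -val_eqE/= in kj; rewrite (negbTE kj) mulr0.
by rewrite -[molecule _ _ _ _]/(molecule x y j (c j)) biorth eqxx mulr1 addr0.
Qed.

(** Both sides are continuous in the functional, so it is enough to check
    the evaluation functionals, which span a dense subspace. *)
Lemma synthesis_analysis :
  (forall a, exists n, forall m, (n <= m)%N -> forall f : A -> R, f a0 = 0 ->
     \sum_(k < m) c k a * molecule x y k f = f a) ->
  forall mu : LF a0, synthesis x y (analysis (closed_span_val mu)) = closed_span_val mu.
Proof.
move=> repro [mu /= muP]; move: muP => /asboolP clmu.
have onspan nu : lin_span (range (@eval_dual R A a0)) nu ->
    synthesis x y (analysis nu) = nu.
  move=> [n [b [v [vS ->]]]].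
  have ev a : synthesis x y (analysis (eval_dual a0 a)) = eval_dual a0 a.
    apply: dual_ext => f; have [N HN] := repro a.
    apply: (@pairing_finite _ _ _ N) => m Nm.
    rewrite -[RHS](HN m Nm f (Lip0_base f)); apply: eq_bigr => k _.
    by rewrite analysisE.
  have s0 : synthesis x y (analysis 0) = 0.
    apply: dual_ext => f; apply: (@pairing_finite _ _ _ 0%N) => m _.
    by rewrite big1// => k _; rewrite analysisE mul0r.
  elim/big_ind: _ => [//|p q IHp IHq|i _].
    by rewrite -[p]scale1r analysis_linear synthesis_linear IHq IHp.
  have [a _ <-] := vS i; rewrite -[_ *: _]addr0.
  by rewrite analysis_linear synthesis_linear ev s0.
apply: dual_ext => f; apply/eqP; rewrite -subr_eq0 -normr_le0.
apply/ler_addgt0Pl => e e0; rewrite addr0.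
(* The difference of both sides is at most [K + 1] times the functional in
   norm; the last [1] avoids dividing by zero. *)
have M0 : 0 < (K + 1) * `|f| + 1 by rewrite ltr_wpDl// mulr_ge0// addr_ge0.
have [nu [nuS]] := clmu _ (nbhsx_ballx mu _ (divr_gt0 e0 M0)).
rewrite -ball_normE /ball_/= => munu.
have -> : synthesis x y (analysis mu) f - mu f =
    synthesis x y (analysis (mu - nu)) f - (mu - nu) f.
  have -> : synthesis x y (analysis mu) = synthesis x y (analysis (mu - nu)) + nu.
    have {1}-> : mu = 1 *: (mu - nu) + nu by rewrite scale1r subrK.
    rewrite analysis_linear synthesis_linear (onspan _ nuS).
    by rewrite scale1r.
  have -> : (synthesis x y (analysis (mu - nu)) + nu : D) f =
    synthesis x y (analysis (mu - nu)) f + nu f by [].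
  have -> : (mu - nu : D) f = mu f - nu f by [].
  by ring.
rewrite (le_trans (ler_normB _ _))// ltW//.
have h1 : `|synthesis x y (analysis (mu - nu)) f| <= K * `|mu - nu| * `|f|.
  rewrite (le_trans (dual_le _ _))// ler_wpM2r// (le_trans (synthesis_le _ _ _))//.
  exact: analysis_le.
have h2 := dual_le (mu - nu) f.
apply: (le_lt_trans (lerD h1 h2)).
move: munu; rewrite ltr_pdivlMr// => /(le_lt_trans _); apply.
by have := normr_ge0 (mu - nu); have := normr_ge0 f; nra.
Qed.

End Factorization.

End LipschitzFree.

(** * Complemented copies of the space of summable sequences *)

Section ComplementedEll1.
Context {R : realType} {A : metricType R} (a0 : A).

Lemma sum_at_most_one n (P : pred nat) :
  (forall i j, P i -> P j -> i = j) -> \sum_(k < n) (P k)%:R <= 1 :> R.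
Proof.
move=> P1; have [i Pi|P0] := pickP (fun k : 'I_n => P k); last first.
  by rewrite big1// => k _; rewrite P0.
rewrite (bigD1 i)//= Pi big1 ?addr0// => k ki.
by case: (boolP (P k)) => // Pk; move: ki; rewrite -val_eqE/= (P1 _ _ Pk Pi) eqxx.
Qed.

Section Bumps.
Context (a : nat -> A) (far : forall n, 3 * mdist (a n) a0 < mdist (a n.+1) a0).
Context (far0 : 0 < mdist (a 0%N) a0).
Local Notation rad n := (mdist (a n) a0).

Lemma rad_gt0 n : 0 < rad n.
Proof.
elim: n => // n IH; apply: le_lt_trans (far n).
by rewrite mulr_ge0// ltW.
Qed.

Lemma rad_growth m n : (m < n)%N -> 3 * rad m < rad n.
Proof.
elim: n => // n IH; rewrite ltnS leq_eqVlt => /predU1P[->//|/IH mn].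
by have := far n; have := rad_gt0 n; lra.
Qed.

(** A function of slope two around [a n], of height and radius proportional
    to the distance to [a0]: far points have disjoint bumps, all of which
    vanish at [a0]. *)
Definition bump n x : R := 2 * Num.max 0 (rad n / 2 - mdist x (a n)).

Lemma bump_supportP n x : bump n x != 0 -> mdist x (a n) < rad n / 2.
Proof.
apply: contra_neqT; rewrite -leNgt => le_x.
by rewrite /bump max_l ?mulr0//; lra.
Qed.

Lemma bump_disjoint x m n : bump m x != 0 -> bump n x != 0 -> m = n.
Proof.
wlog mn : m n / (m < n)%N => [wl hm hn|/bump_supportP hm /bump_supportP hn].
  by have [/wl|/wl w|//] := ltngtP m n; [exact|apply/esym; exact: w].
exfalso; have := rad_growth mn; have := metric_triangle (a n) x a0.
have := metric_triangle x (a m) a0; rewrite (metric_sym (a n) x); lra.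
Qed.

Lemma bump_lip n x y : `|bump n x - bump n y| <= 2 * mdist x y.
Proof.
have := metric_triangle x y (a n); have := metric_triangle y x (a n).
rewrite /bump (metric_sym y x) => h1 h2.
rewrite -mulrBr normrM (ger0_norm (ler0n _ 2)) ler_wpM2l// ler_norml.
have d0 := mdist_ge0 x y.
by case: (leP 0 (_ - mdist x _)) => h3; case: (leP 0 (_ - mdist y _)) => h4; lra.
Qed.

Lemma bump_sum_lip n x y : \sum_(k < n) `|bump k x - bump k y| <= 4 * mdist x y.
Proof.
apply: (@le_trans _ _ (\sum_(k < n)
    2 * mdist x y * ((bump k x != 0)%:R + (bump k y != 0)%:R))).
  apply: ler_sum => k _; have := bump_lip k x y; have := mdist_ge0 x y.
  case: eqP => [->|_]; case: eqP => [->|_] //=; rewrite ?subrr ?normr0; lra.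
rewrite -mulr_sumr big_split/= [leRHS](_ : _ = 2 * mdist x y * (1 + 1)); last by ring.
apply: ler_wpM2l; first by rewrite mulr_ge0// mdist_ge0.
apply: lerD.
  by apply: (@sum_at_most_one n (fun k => bump k x != 0)) => i j; exact: bump_disjoint.
by apply: (@sum_at_most_one n (fun k => bump k y != 0)) => i j; exact: bump_disjoint.
Qed.

Lemma bump_center n : bump n (a n) = rad n.
Proof. by rewrite /bump mdistxx subr0 max_r; have := rad_gt0 n; lra. Qed.

Lemma bump_base n : bump n a0 = 0.
Proof.
by rewrite /bump (metric_sym a0) max_l ?mulr0//; have := rad_gt0 n; lra.
Qed.

Lemma bump_biorthogonal j k :
  molecule (fun=> a0) a k (bump j) = (j == k)%:R.
Proof.
rewrite /molecule bump_base subr0 metric_sym; case: eqVneq => [->|jk].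
  by rewrite bump_center divff// gt_eqF// rad_gt0.
suff -> : bump j (a k) = 0 by rewrite mul0r.
apply/eqP; apply: contra_neqT jk => bj; apply: bump_disjoint bj _.
by rewrite bump_center gt_eqF// rad_gt0.
Qed.

End Bumps.

Lemma far_sequence : (forall M : R, exists a, M < mdist a a0) ->
  exists a : nat -> A, 0 < mdist (a 0%N) a0 /\
    forall n, 3 * mdist (a n) a0 < mdist (a n.+1) a0.
Proof.
move=> unb; have [next nextP] := choice (fun b => unb (3 * mdist b a0)).
exists (fun n => iter n.+1 next a0); split=> [|n]; last exact: nextP.
by have := nextP a0; rewrite mdistxx mulr0.
Qed.

Lemma LF_isomorphic_ell1 (c : nat -> A -> R) (K : R) (x y : nat -> A) :
  0 <= K -> (forall k, c k a0 = 0) ->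
  (forall n a b, \sum_(k < n) `|c k a - c k b| <= K * mdist a b) ->
  (forall a, exists n, forall m, (n <= m)%N -> forall f : A -> R, f a0 = 0 ->
     \sum_(k < m) c k a * molecule x y k f = f a) ->
  (forall M : R, exists a, M < mdist a a0) ->
  isomorphic (LF a0) (ell1 R).
Proof.
move=> K0 c_base c_lip repro /far_sequence[a [a_gt0 far]].
have four : 0 <= 4 :> R by [].
have bumpB : forall k, bump a k a0 = 0 by exact: bump_base.
have bumpL := bump_sum_lip far a_gt0.
pose an (e : nat -> A -> R) M (M0 : 0 <= M) eb el (mu : LF a0) :=
  @analysis R A a0 e M M0 eb el (closed_span_val mu).
have an_lin e M M0 eb el : linear (@an e M M0 eb el).
  by move=> b mu nu; rewrite /an -analysis_linear.
pose I : {linear LF a0 -> ell1 R} := HB.pack (an c K K0 c_base c_lip)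
  (GRing.isLinear.Build R (LF a0) (ell1 R) *:%R _ (an_lin c K K0 c_base c_lip)).
pose q : {linear LF a0 -> ell1 R} := HB.pack (an (bump a) 4 four bumpB bumpL)
  (GRing.isLinear.Build R (LF a0) (ell1 R) *:%R _ (an_lin (bump a) 4 four bumpB bumpL)).
pose r : {linear ell1 R -> LF a0} := HB.pack (@synthesis_LF R A a0 x y)
  (GRing.isLinear.Build R (ell1 R) (LF a0) *:%R _ (@synthesis_LF_linear R A a0 x y)).
pose J : {linear ell1 R -> LF a0} := HB.pack (@synthesis_LF R A a0 (fun=> a0) a)
  (GRing.isLinear.Build R (ell1 R) (LF a0) *:%R _ (@synthesis_LF_linear R A a0 (fun=> a0) a)).
apply: (@pelczynski R (LF a0) I r J q).
- by exists K => mu; exact: analysis_le.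
- by exists 1 => u; rewrite mul1r; exact: synthesis_le.
- by exists 1 => u; rewrite mul1r; exact: synthesis_le.
- by exists 4 => mu; exact: analysis_le.
- by move=> mu; apply: val_inj; exact: synthesis_analysis repro mu.
- move=> u; apply: (analysis_synthesis four bumpB bumpL).
  exact: bump_biorthogonal.
Qed.

End ComplementedEll1.

(** * Random trees on the points of a metric space *)

Section Edges.
Context {R : realType} {A : metricType R}.
Context (e : nat -> A * A) (rank : A * A -> nat).
Context (eK : cancel e rank) (rankK : cancel rank e).
Implicit Types (x y : A) (p q : seq A).

Definition edges x p : seq (A * A) := zip (x :: p) p.

(** The contribution of the pair [e k] to the length of the walk [p] from
    [x]. *)
Definition edge_weight k x p : R :=
  mdist (e k).1 (e k).2 * (count_mem (e k) (edges x p))%:R.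

Lemma edge_weight_ge0 k x p : 0 <= edge_weight k x p.
Proof. by rewrite mulr_ge0// mdist_ge0. Qed.

Lemma edge_weight_cons k x y p : edge_weight k x (y :: p) =
  mdist (e k).1 (e k).2 * ((x, y) == e k)%:R + edge_weight k y p.
Proof. by rewrite /edge_weight /= natrD mulrDr. Qed.

Lemma edge_weight_cat k x p q :
  edge_weight k x (p ++ q) = edge_weight k x p + edge_weight k (last x p) q.
Proof.
elim: p x => [|y p IH] x; last by rewrite cat_cons !edge_weight_cons IH addrA.
by rewrite cat0s {2}/edge_weight /= mulr0 add0r.
Qed.

Lemma sum_edge_weight_le n x p : \sum_(k < n) edge_weight k x p <= walk_length x p.
Proof.
elim: p x => [|y p IH] x.
  by rewrite big1// => k _; rewrite /edge_weight /= mulr0.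
under eq_bigr do rewrite edge_weight_cons.
rewrite big_split/=; apply: lerD => //.
apply: (@le_trans _ _ (\sum_(k < n) mdist x y * ((x, y) == e k)%:R)).
  by apply: ler_sum => k _; case: eqVneq => [<-|_]//=; rewrite !mulr0.
rewrite -mulr_sumr -[leRHS]mulr1; apply: ler_wpM2l; first exact: mdist_ge0.
apply: (@sum_at_most_one _ n (fun k => (x, y) == e k)) => i j /eqP-> /eqP.
exact: (can_inj eK).
Qed.

Lemma sum_edge_weight_diff n x p q :
  \sum_(k < n) `|edge_weight k x p - edge_weight k x q| <= walk_dist x p q.
Proof.
have [c [p' [q' [-> -> ->]]]] := walk_dist_eq x p q.
apply: (@le_trans _ _ (\sum_(k < n) 
    (edge_weight k (last x c) p' + edge_weight k (last x c) q'))).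
  apply: ler_sum => k _; rewrite !edge_weight_cat opprD addrACA subrr add0r.
  rewrite (le_trans (ler_normB _ _))//.
  by rewrite !ger0_norm ?edge_weight_ge0.
by rewrite big_split/= lerD// sum_edge_weight_le.
Qed.

Lemma sum_edge_molecule m x p (f : A -> R) :
  all (fun xy => (rank xy < m)%N) (edges x p) ->
  \sum_(k < m) edge_weight k x p * molecule (fun k => (e k).1) (fun k => (e k).2) k f
  = f (last x p) - f x.
Proof.
elim: p x => [|y p IH] x.
  by move=> _; rewrite big1 ?subrr// => k _; rewrite /edge_weight /= mulr0 mul0r.
move=> /= /andP[xym /IH {}IH].
under eq_bigr do rewrite edge_weight_cons mulrDl.
rewrite big_split/= IH (bigD1 (Ordinal xym))//= big1 => [|k km]; last first.
  suff /negbTE -> : (x, y) != e k by rewrite mulr0 mul0r.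
  by apply: contra_neq km => xye; apply: val_inj; rewrite /= xye eK.
rewrite rankK eqxx mulr1 addr0 /molecule rankK /=.
have [->|xy] := eqVneq x y; first by rewrite mdistxx mul0r add0r.
by rewrite mulrC divfK ?gt_eqF ?mdist_gt0//; ring.
Qed.

End Edges.

Section RandomWalks.
Context {R : realType} {A : metricType R} (a0 : A)
    (disp : measure_display) (Omega : measurableType disp)
    (P : probability Omega R) (walk : Omega -> A -> seq A).

(** A random tree on the points of [A], rooted at [a0] and presented by the
    walks that lead from the root to each point.  The tree distance of two
    points is that of their walks, and it is never less than the distance in
    [A], by the triangle inequality ([mdist_last_walk_dist]). *)
Definition random_walks (K : R) := [/\
  forall a, finite_rv (fun w => walk w a),
  forall w a, last a0 (walk w a) = a,
  forall w, walk w a0 = [:: a0] &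
  forall a b, \int[P]_w walk_dist a0 (walk w a) (walk w b) <= K * mdist a b].

Context (K : R) (K0 : 0 < K) (walkP : random_walks K).

Lemma walk_rv2 T (F : seq A -> seq A -> T) a b :
  finite_rv (fun w => F (walk w a) (walk w b)).
Proof.
case: walkP => fw _ _ _.
by apply: finite_rv_factor (finite_rv_pair (fw a) (fw b)) _ => w w' [-> ->].
Qed.

Lemma random_walks_Rtree : exists (T : metricType R) (t0 : T),
  Rtree T /\ stochastic_biLipschitz_embeds a0 t0.
Proof.
case: walkP => fw lastw w0 Ew.
pose psi w a : kernel_tree (walk_kernel a0) := tree_embed (walk_kernel a0) (walk w a).
exists (kernel_tree (walk_kernel a0)), (tree_embed (walk_kernel a0) [:: a0]).
split; first exact: kernel_tree_Rtree.
exists disp, Omega, P, psi; split.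
  have fpsi a : finite_rv (fun w => psi w a).
    by apply: finite_rv_factor (fw a) _ => w w'; rewrite /psi => ->.
  split=> [a B _|a|]; first exact: (finite_rv_preimage B (fpsi a)).
  - exists (range (fun w => psi w a)); split; last by apply: aeW => w; exists w.
    exists (range (fun w => psi w a)); split=> //; last exact: subset_closure.
    by apply: finite_set_countable; exact: (fpsi a).1.
  - by apply: aeW => w; rewrite /psi w0.
exists K, 1; split=> // a b; split.
  apply: aeW => w; rewrite mul1r mdist_walk_tree.
  by rewrite -{1}(lastw w a) -{1}(lastw w b) mdist_last_walk_dist.
rewrite mul1r unlock.
under eq_integral do rewrite mdist_walk_tree.
have int := finite_rv_integrable P (walk_rv2 (walk_dist a0) a b).
rewrite -[leLHS]fineK; last exact: integrable_fin_num.
by rewrite lee_fin; exact: Ew.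
Qed.

Lemma expectation_sum n (Y : nat -> Omega -> R) : (forall k, finite_rv (Y k)) ->
  finite_rv (fun w => \sum_(k < n) Y k w) /\
  \int[P]_w (\sum_(k < n) Y k w) = \sum_(k < n) \int[P]_w Y k w.
Proof.
move=> fY; elim: n => [|n [fS IH]].
  under [X in finite_rv X]eq_fun do rewrite big_ord0.
  under eq_Rintegral do rewrite big_ord0.
  by rewrite big_ord0 expectation_cst; split => //; exact: finite_rv_cst.
under [X in finite_rv X]eq_fun do rewrite big_ord_recr/=.
under eq_Rintegral do rewrite big_ord_recr/=.
rewrite big_ord_recr/= -IH RintegralD//; [|exact: finite_rv_integrable..].
by split => //; apply: finite_rv_factor (finite_rv_pair fS (fY n)) _ => w w' [-> ->].
Qed.

Lemma le_expectation (Y Z : Omega -> R) : finite_rv Y -> finite_rv Z ->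
  {ae P, forall w, Y w <= Z w} -> \int[P]_w Y w <= \int[P]_w Z w.
Proof.
move=> fY fZ YZ; rewrite -lee_fin /Rintegral !fineK.
- by apply: ae_le_integral_any => //; apply: filterS YZ => w; rewrite lee_fin.
- exact: integrable_fin_num (finite_rv_integrable P fZ).
- exact: integrable_fin_num (finite_rv_integrable P fY).
Qed.

(** The coefficient [c k a] is the expected flow through the [k]-th pair of
    points of the walk to [a].  Walks to [a] and [b] differ only after their
    common prefix, so the flows differ in [ell1] by at most the expected tree
    distance; and a walk to [a] telescopes to the evaluation at [a]. *)
Lemma random_walks_ell1 : countable [set: A] -> infinite_set [set: A] ->
  (forall M : R, exists a, M < mdist a a0) -> isomorphic (LF a0) (ell1 R).
Proof.
case: walkP => fw lastw w0 Ew cA iA unb.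
have [e [rank [eK rankK]]] : exists (e : nat -> A * A) (rank : A * A -> nat),
    cancel e rank /\ cancel rank e.
  have iAA : infinite_set [set: A * A].
    apply: contra_not iA => /(finite_image fst); apply: sub_finite_set => a _.
    by exists (a, a0).
  have cAA : countable [set: A * A] by rewrite -setXTT; exact: countableX.
  have /card_bijP[f [g fK gK]] := eq_card_nat cAA iAA.
  exists (fun n => val (g (exist _ n (in_setT n)))).
  exists (fun xy => val (f (exist _ xy (in_setT xy)))); split=> x /=.
    rewrite [X in f X](_ : _ = g (exist _ x (in_setT x))) ?gK//.
    exact: val_inj.
  rewrite [X in g X](_ : _ = f (exist _ x (in_setT x))) ?fK//.
  exact: val_inj.
pose c k a := \int[P]_w edge_weight e k a0 (walk w a).
have fweight k a : finite_rv (fun w => edge_weight e k a0 (walk w a)).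
  by apply: finite_rv_factor (fw a) _ => w w' ->.
apply: (@LF_isomorphic_ell1 _ _ _ c K (fun k => (e k).1) (fun k => (e k).2)) => //.
- exact: ltW.
- move=> k; rewrite /c; under eq_Rintegral do rewrite w0.
  rewrite expectation_cst /edge_weight /=.
  by case: eqVneq => [<-|_]; rewrite ?mdistxx ?mul0r// mulr0.
- move=> n a b; apply: le_trans (Ew a b).
  have fdiff k := walk_rv2
    (fun p q => `|edge_weight e k a0 p - edge_weight e k a0 q|) a b.
  apply: (@le_trans _ _ (\sum_(k < n) \int[P]_w
      `|edge_weight e k a0 (walk w a) - edge_weight e k a0 (walk w b)|)).
    apply: ler_sum => k _; rewrite /c -RintegralB//; [|exact: finite_rv_integrable..].
    apply: le_normr_Rintegral => //; apply: finite_rv_integrable.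
    exact: (walk_rv2 (fun p q => edge_weight e k a0 p - edge_weight e k a0 q)).
  have [fS <-] := expectation_sum n fdiff.
  apply: le_expectation => //; first exact: (walk_rv2 (walk_dist a0)).
  by apply: aeW => w; exact: sum_edge_weight_diff.
- move=> a; have /finite_seqP[s sE] := (fw a).1.
  pose n := (\max_(xy <- flatten [seq edges a0 p | p <- s]) rank xy).+1.
  exists n => m nm f f0.
  have alln w : all (fun xy => (rank xy < m)%N) (edges a0 (walk w a)).
    apply/allP => xy xyE; apply: leq_trans nm; rewrite ltnS.
    apply: leq_bigmax_seq => //; apply/flattenP; exists (edges a0 (walk w a)) => //.
    apply/mapP; exists (walk w a) => //.
    by have : [set` s] (walk w a) by rewrite -sE; exists w.
  have E w := sum_edge_molecule eK rankK f (alln w).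
  transitivity (\sum_(k < m) \int[P]_w (edge_weight e k a0 (walk w a) *
      molecule (fun k => (e k).1) (fun k => (e k).2) k f)).
    apply: eq_bigr => k _; rewrite /c RintegralZr//.
    exact: finite_rv_integrable.
  have [_ <-] := expectation_sum m (fun k => finite_rv_comp
    (fun t : R => t * molecule (fun k => (e k).1) (fun k => (e k).2) k f) (fweight k a)).
  under eq_Rintegral do rewrite /= E lastw f0 subr0.
  by rewrite expectation_cst.
Qed.

End RandomWalks.

(** * The random tree of a subset of a hyperbolic space *)

Section LocallyFinite.
Context {R : realType} {A : metricType R} (a0 : A).
Hypothesis lfA : locally_finite_space A.

Lemma finite_ball (r : R) : finite_set [set a : A | mdist a a0 <= r].
Proof.
apply: lfA; exists (r + r) => x y /= xr yr.
by rewrite (le_trans (metric_triangle _ a0 _))// lerD// metric_sym.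
Qed.

Lemma locally_finite_countable : countable [set: A].
Proof.
rewrite (_ : setT = \bigcup_n [set a : A | mdist a a0 <= n%:R]).
  by apply: bigcup_countable => // n _; apply: finite_set_countable; exact: finite_ball.
apply/seteqP; split=> // a _; exists (Num.truncn (mdist a a0)).+1 => //=.
exact/ltW/truncnS_gt.
Qed.

Lemma infinite_unbounded : infinite_set [set: A] ->
  forall M : R, exists a : A, M < mdist a a0.
Proof.
move=> iA M; apply: contrapT => no; apply: iA.
apply: sub_finite_set (finite_ball M) => a _ /=.
by rewrite leNgt; apply/negP => Ma; apply: no; exists a.
Qed.

End LocallyFinite.

(** The root of the tree is the ball of radius [B], which contains everything,
    and heights are measured from the image of [a0], which is thus at the
    root: the walk to [a0] is the same for all outcomes. *)
Lemma boundary_random_walks (R : realType) (A : metricType R) (a0 : A)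
    (X : metricType R) (d : visual_metric X) :
  uniformly_discrete A -> locally_finite_space A ->
  hyperbolic X -> visual X -> rough_biLipschitz_embeds A X ->
  (forall xi : visual_boundary d,
     exists (U : metricType R) (u0 : U),
       [/\ bounded_space U, ultrametric U &
           log_stochastic_biLipschitz_embeds xi u0]) ->
  exists (disp : measure_display) (Omega : measurableType disp)
    (P : probability Omega R) (walk : Omega -> A -> seq A) (K : R),
    0 < K /\ random_walks a0 P walk K.
Proof.
move=> [theta theta0 disc] lfA hypX visX [f [K0 [L [K00 L0 fP]]]] logU.
pose o := f a0.
have [xi [eps [C [eps0 C0 H1 H2]]]] := boundary_shadow o d hypX visX.
pose z a : visual_boundary d := xi (f a).
have [U [u0 [bU uU embU]]] := logU (z a0).
have cA := locally_finite_countable a0 lfA.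
have [B [s [D [disp [ Omega [P [u [B0 s0 D0 uP]]]]]]]] :=
  log_embedding_random_ultrametric z cA bU uU embU.
pose h a := Num.truncn (mdist (f a) o).
have hle a : (h a)%:R <= mdist (f a) o by rewrite truncn_le// mdist_ge0.
have hgt a : mdist (f a) o < (h a)%:R + 1 by rewrite natr1 truncnS_gt.
have ha0 : h a0 = 0%N by rewrite /h mdistxx truncn0.
pose lev w := parting_level h eps B (u w).
have levP w : tree_profile h (lev w) by exact: (random_profile B0 uP h eps0).
pose T w a b : nat := (h a + h b - (lev w a b).*2)%N.
have gpE a b : mdist (f a) (f b) =
    mdist (f a) o + mdist (f b) o - 2 * gromov_prod o (f a) (f b).
  by rewrite /gromov_prod (metric_sym o (f b)); field.
have fdist a b : mdist a b <= L * (mdist (f a) (f b) + K0).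
  by have [+ _] := fP a b; rewrite lerBlDr ler_pdivrMl.
(* A common ball at level [n] bounds the visual metric by a multiple of
   [expR (- eps * n)], hence the Gromov product by [n] from below. *)
have [C2 H2'] := H2 _ (divr_gt0 B0 s0).
pose K1 := L * (2 + 2 * `|C2| + K0).
have K10 : 0 <= K1 by rewrite mulr_ge0 ?(ltW L0)// !addr_ge0// mulr_ge0.
have ae_profile : {ae P, forall w, forall a b, mdist a b <= L * (T w a b)%:R + K1}.
  apply: filterS (ru_lower uP) => w low a b.
  have := leqnn (lev w a b).
  rewrite leq_parting_level//; last exact: (ru_lt uP).
  move=> /and3P[la lb uab].
  have lev_gp : (lev w a b)%:R - C2 <= gromov_prod o (f a) (f b).
    apply: H2'.
    - by rewrite (le_trans _ (hle a))// ler_nat.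
    - by rewrite (le_trans _ (hle b))// ler_nat.
    - rewrite mulrAC ler_pdivlMr// mulrC; apply: le_trans (ltW uab).
      exact: low.
  rewrite (le_trans (fdist a b))// /K1 -mulrDr ler_pM2l// gpE /T.
  rewrite natrB; last by lia.
  rewrite natrD -mul2n natrM.
  have := hgt a; have := hgt b; have := ler_norm C2; move: lev_gp; lra.
(* [C3] adds up the rounding of heights, the multiplicative constants of the
   visual metric and of the ultrametric, and the expected distortion [D]. *)
pose c3 := 2 / eps * (ln s + ln C - ln B).
pose C3 := 2 + `|c3| + 2 / eps * `|ln D|.
have C30 : 0 <= C3.
  by rewrite !addr_ge0// mulr_ge0// divr_ge0// ltW.
have ET a b : \int[P]_w (T w a b)%:R <= mdist (f a) (f b) + C3.
  have c3_le := ler_norm c3; have c3_ge0 := normr_ge0 c3.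
  have d0 := mdist_ge0 (f a) (f b).
  have := @expected_split_length _ _ _ z B s D _ _ P u B0 s0 D0 uP h eps eps0 a b
    (mdist (f a) (f b) + 2 + `|c3|).
  rewrite -!addrA => /(_ _ _ _)/le_trans; rewrite /C3 -!addrA; apply=> //.
  - by rewrite !addr_ge0.
  - rewrite ler_norml.
    have := metric_triangle (f a) (f b) o; have := metric_triangle (f b) (f a) o.
    rewrite (metric_sym (f b) (f a)).
    by have := hle a; have := hle b; have := hgt a; have := hgt b; lra.
  - move=> zab; have zab0 : 0 < mdist (z a) (z b) by rewrite mdist_gt0; apply/eqP.
    have lnd : ln (mdist (z a) (z b)) <= ln C - eps * gromov_prod o (f a) (f b).
      have -> : ln C - eps * gromov_prod o (f a) (f b) =
          ln (C * expR (- (eps * gromov_prod o (f a) (f b)))).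
        by rewrite lnM ?posrE ?expR_gt0// expRK.
      by rewrite ler_ln ?posrE ?mulr_gt0 ?expR_gt0//; exact: H1.
    rewrite lnM ?posrE//.
    have /(ler_wpM2l (_ : 0 <= 2 / eps)) := lnd.
    have -> : 2 / eps * (ln C - eps * gromov_prod o (f a) (f b)) =
       2 / eps * ln C - 2 * gromov_prod o (f a) (f b).
      by field; rewrite gt_eqF.
    rewrite divr_ge0 ?(ltW eps0)// => /(_ isT).
    rewrite gpE; move: c3_le; rewrite /c3.
    by have := hle a; have := hle b; lra.
pose walk w a := branch a0 h (lev w) a.
have walk_rv a : finite_rv (fun w => walk w a).
  (* Only the levels between points not higher than [a] matter, and there are
     finitely many such points. *)
  have fin : finite_set [set b : A | (h b <= h a)%N].
    apply: sub_finite_set (finite_ball a0 lfA (L * ((h a)%:R + 1 + K0))) => b /= hb.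
    rewrite (le_trans (fdist b a0))// ler_pM2l// lerD2r (le_trans (ltW (hgt b)))//.
    by rewrite lerD2r ler_nat.
  have /finite_seqP[t tE] := fin.
  have := finite_rv_seq t (fun b => finite_rv_seq t (fun c => parting_level_rv B0 uP h eps0 b c)).
  move=> /finite_rv_factor; apply => w w' E.
  apply: (@eq_branch _ _ a0 h (lev w) (lev w') (h a)) => // b c hb hc.
  have tb : b \in t by have : [set` t] b by rewrite -tE.
  have tc : c \in t by have : [set` t] c by rewrite -tE.
  by have /eq_in_map/(_ b tb)/eq_in_map/(_ c tc) := E.
pose C4 := 4 * (2 * L + K1).
have C40 : 0 <= C4 by rewrite mulr_ge0// addr_ge0// mulr_ge0// ltW.
(* Distances between distinct points are at least [theta], which turns the
   additive constants into multiplicative ones. *)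
pose K2 := C4 * (L + (K0 + C3) / theta) + 2 * K1 / theta + 1.
have K2_ge0 : 0 < K2.
  have q1 : 0 <= (K0 + C3) / theta by exact: divr_ge0 (addr_ge0 K00 C30) (ltW theta0).
  have q2 : 0 <= 2 * K1 / theta by exact: divr_ge0 (mulr_ge0 (ler0n _ 2) K10) (ltW theta0).
  have q3 := mulr_ge0 C40 (addr_ge0 (ltW L0) q1).
  by move: q2 q3; rewrite /K2; lra.
exists disp, Omega, P, walk, K2; split=> //; split => //.
- by move=> w a; rewrite /walk /branch last_rcons.
- by move=> w; rewrite /walk /branch ha0.
move=> a b; have [<-|ab] := pselect (a = b).
  under eq_Rintegral do rewrite /walk_dist walk_prodxx.
  rewrite mdistxx mulr0 (_ : (fun _ => _) = (fun=> 0)) ?expectation_cst//.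
  by apply/funext => w; ring.
have thab := disc _ _ ab.
have T_rv := split_length_rv B0 uP h eps0 a b.
apply: (@le_trans _ _ (\int[P]_w (C4 * (T w a b)%:R + 2 * K1))).
  apply: le_expectation.
  - by apply: finite_rv_factor (finite_rv_pair (walk_rv a) (walk_rv b)) _ => w w' [-> ->].
  - exact: (finite_rv_comp (fun t : R => C4 * t + 2 * K1) T_rv).
  - apply: filterS ae_profile => w prof.
    exact: (branch_dist (levP w) ha0 (ltW L0) K10 prof).
rewrite expectation_affine//.
have := ler_wpM2l C40 (ET a b).
have [_ fup] := fP a b; have := ler_wpM2l C40 fup.
have scale c : 0 <= c -> c <= c / theta * mdist a b.
  by move=> c0; rewrite mulrAC ler_pdivlMr// ler_wpM2l.
have e1 := ler_wpM2l C40 (scale _ (addr_ge0 K00 C30)).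
have e2 := scale _ (mulr_ge0 (ler0n _ 2) K10).
have := mdist_ge0 a b; rewrite /K2; move: e1 e2.
by rewrite !mulrDr !mulrDl; lra.
Qed.

Theorem theorem3 (R : realType)
    (A : metricType R) (a0 : A) (X : metricType R) (x0 : X)
    (d : visual_metric X) :
  infinite_set [set: A] -> uniformly_discrete A -> locally_finite_space A ->
  hyperbolic X -> visual X ->
  rough_biLipschitz_embeds A X ->
  (forall xi : visual_boundary d,
     exists (U : metricType R) (u0 : U),
       [/\ bounded_space U, ultrametric U &
           log_stochastic_biLipschitz_embeds xi u0]) ->
  (exists (T : metricType R) (t0 : T),
     Rtree T /\ stochastic_biLipschitz_embeds a0 t0) /\
  isomorphic (LF a0) (ell1 R).
Proof.
move=> iA udA lfA hypX visX embA logU.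
have [disp [ Omega [P [walk [K [K0 walkP]]]]]] :=
  boundary_random_walks a0 udA lfA hypX visX embA logU.
split; first exact: random_walks_Rtree K0 walkP.
apply: (random_walks_ell1 K0 walkP _ iA); first exact: (locally_finite_countable a0 lfA).
exact: (infinite_unbounded a0 lfA iA).
Qed.
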